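(* Consider a non-resonant capillary-gravity wave with parameters $(\beta,\kappa)$ in the super-critical region ($\mu_0(\kappa;\beta)>1$) admitting $(k_j(\sigma),k_{j'}(\sigma),1)\in\mathcal R(\sigma)$ at a non-critical $\sigma>0$ where $\dim Y(\sigma)=4$, and suppose that the two remaining real numbers $k_r,k_s$ for which $ik_r,ik_s$ are eigenvalues of $\mathbf L(i\sigma)$ satisfy $k_r,k_s\not\equiv k_j,k_{j'}\pmod\kappa$. Let $$W(\delta,\gamma,\varepsilon)=\delta^2+a_1(\gamma,\varepsilon)\delta+a_0(\gamma,\varepsilon)$$ be the (quadratic) Weierstrass polynomial associated with the expansion of the periodic Evans function at $(i\sigma,k_j(\sigma)+p\kappa;0)$, and let $\delta(\gamma,\varepsilon)=-\frac{a_1(\gamma,\varepsilon)}2\pm\frac{\sqrt{a_1(\gamma,\varepsilon)^2-4a_0(\gamma,\varepsilon)}}2$ be its roots, $\gamma,\varepsilon\in\mathbb R$ small. Then $a_1(\gamma,\varepsilon)$ is purely imaginary and $a_0(\gamma,\varepsilon)$ is real. Consequently $-a_1(\gamma,\varepsilon)/2$ is purely imaginary, the discriminant $$\mathrm{disc}(\gamma,\varepsilon):=a_1(\gamma,\varepsilon)^2-4a_0(\gamma,\varepsilon)$$ is real, and the stability of $\delta(\gamma,\varepsilon)$ (i.e. whether the roots are purely imaginary or have non-zero real parts) is completely determined by the sign of $\mathrm{disc}(\gamma,\varepsilon)$.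
   Context: **Wave.** Fix $\beta>0$, $\kappa>0$; put $T=2\pi/\kappa$, $\mu_0(k;\beta)=\frac{k}{(1+\beta k^2)\tanh k}$, $\mu_0=\mu_0(\kappa;\beta)$. A non-resonant capillary-gravity wave of small amplitude is a family $(\bar\phi(x,y),\bar\eta(x),\mu,q)$, real analytic in $\varepsilon\in\mathbb R$, $|\varepsilon|\ll1$, with $\bar\phi=\varepsilon\sin(\kappa x)\cosh(\kappa y)+O(\varepsilon^2)$, $\bar\eta=\varepsilon\sinh(\kappa)\cos(\kappa x)+O(\varepsilon^2)$, $\mu=\mu_0+O(\varepsilon^2)$, $q=O(\varepsilon^2)$, where no positive root $k\ne\kappa$ of $\mu_0(k;\beta)=\mu_0$ has $k/\kappa$ rational; $\bar\phi$ is odd in $x$, $\bar\eta$ is even in $x$ with zero mean, both are $T$-periodic in $x$, and with $\bar u=\bar\phi_x-\frac{y\bar\eta_x\bar\phi_y}{1+\bar\eta}$, $\bar z=\beta\bar\eta_x(1+\bar\eta_x^2)^{-1/2}$ they satisfy $\bar u_x-\frac{y\bar\eta_x\bar u_y}{1+\bar\eta}+\frac{\bar\phi_{yy}}{(1+\bar\eta)^2}=0$ for $0<y<1$; $\bar\phi_y=0$ at $y=0$; $(\bar u-1)\bar\eta_x-\frac{\bar\phi_y}{1+\bar\eta}=0$ and $\mu\bar z_x+\bar u-\frac{\bar u^2}{2}-\mu\bar\eta-\frac{\bar\phi_y^2}{2(1+\bar\eta)^2}+q=0$ at $y=1$. **Spectral problem.** Let $s=(1+\bar\eta_x^2)^{3/2}$.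 Perturbations $e^{\lambda t}(\phi,u,\eta,z)$ of the wave satisfy the linearized equations: for $0<y<1$, $\phi_x-\frac{y\bar\eta_x}{1+\bar\eta}\phi_y+\frac{y\bar\eta_x\bar\phi_y}{(1+\bar\eta)^2}\eta-\frac{y\bar\phi_ys}{\beta(1+\bar\eta)}z-u=0$, $u_x-\frac{y\bar\eta_x}{1+\bar\eta}u_y+\frac{y\bar\eta_x\bar u_y}{(1+\bar\eta)^2}\eta-\frac{y\bar u_ys}{\beta(1+\bar\eta)}z+\frac{\phi_{yy}}{(1+\bar\eta)^2}-\frac{2\bar\phi_{yy}}{(1+\bar\eta)^3}\eta=0$; at $y=1$, $\eta_x-\frac{s}{\beta}z=0$, $\lambda\phi-\mu z_x-u+\frac{(\bar u-1)\bar\phi_ys}{\beta(1+\bar\eta)}z+\frac{\bar\phi_y\bar\eta_x}{1+\bar\eta}u+\bar uu+\mu\eta=0$, $\lambda\eta+(\bar u-1)\frac{s}{\beta}z+\bar\eta_xu-\frac{\phi_y}{1+\bar\eta}+\frac{\bar\phi_y}{(1+\bar\eta)^2}\eta=0$; and $\phi_y=0$ at $y=0$. Replacing $\phi$ by $\varphi$ through $\phi=(1-\bar u(\cdot,1))(1+\bar\eta)s\,\varphi+\bar\eta_x(1+\bar\eta)\int_0^yy'u(\cdot,y')dy'+\big(\lambda(1+\bar\eta)+\frac{\bar\phi_y(\cdot,1)}{1+\bar\eta}\big)\frac{y^2\eta}{2}$, the last two boundary conditions become $\varphi_y(1)+z/\beta=0$, $\varphi_y(0)=0$, and the other equations become $\mathbf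 u_x=\mathbf L(\lambda)\mathbf u+\mathbf B(x;\lambda,\varepsilon)\mathbf u$, $\mathbf u=(\varphi,u,\eta,z)^T$, where $\mathbf B(x;\lambda,0)=0$, $\mathbf B$ is $T$-periodic in $x$, and $\mathbf L(\lambda)\mathbf u=\big(u-\frac{\lambda y^2z}{2\beta},\ -\varphi_{yy}-\lambda\eta,\ \frac z\beta,\ \frac{\lambda^2\eta}{2\mu_0}+\frac{\lambda\varphi(1)}{\mu_0}+\eta-\frac{u(1)}{\mu_0}\big)^T$ on $Y=H^1(0,1)\times L^2(0,1)\times\mathbb C^2$ with $\mathrm{dom}(\mathbf L)=\{\mathbf u\in H^2\times H^1\times\mathbb C^2:\varphi_y(1)+z/\beta=0,\ \varphi_y(0)=0\}$. **Resonance.** For $\sigma\in\mathbb R$, let $ik_j(\sigma)$ ($k_j(\sigma)\in\mathbb R$) be the purely imaginary eigenvalues of $\mathbf L(i\sigma)$, corresponding to the real roots $k$ of $(\sigma-k)^2=\mu_0k\tanh(k)(1+\beta k^2)$; $\sigma\neq0$ is critical if one of them is a double eigenvalue. $\mathcal R(\sigma)=\{(k_j(\sigma),k_{j'}(\sigma),N):k_j(\sigma)-k_{j'}(\sigma)=N\kappa,\ N\in\mathbb N,\ N\ge1\}$. **Periodic Evans function.** Let $Y(\sigma)$ be the (finite-dimensional) sum of generalized eigenspaces of $\mathbf L(i\sigma)$ for its purely imaginary eigenvalues, $\boldsymbol\Pi(\sigma)$ the spectral projection onto $Y(\sigma)$ commuting with $\mathbf L(i\sigma)$, $\mathcal B(\sigma)$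 an ordered basis of $Y(\sigma)$ of (generalized) eigenvectors. Put $\mathbf B(x;\sigma,\delta,\varepsilon)=\mathbf L(i\sigma+\delta)-\mathbf L(i\sigma)+\mathbf B(x;i\sigma+\delta,\varepsilon)$. By Mielke's reduction theorem, for $|\delta|,|\varepsilon|\ll1$ there is a map $\mathbf w(x,\mathbf v;\sigma,\delta,\varepsilon)$ with values in $\mathrm{dom}(\mathbf L)\cap\ker\boldsymbol\Pi(\sigma)$ such that $\mathbf v+\mathbf w$ is a bounded solution of $\mathbf u_x=\mathbf L(i\sigma+\delta)\mathbf u+\mathbf B(x;i\sigma+\delta,\varepsilon)\mathbf u$ iff $\mathbf v(x)\in Y(\sigma)$ is a bounded solution of $\mathbf v_x=\mathbf L(i\sigma)\mathbf v+\boldsymbol\Pi(\sigma)\mathbf B(x;\sigma,\delta,\varepsilon)(\mathbf v+\mathbf w(x,\mathbf v;\sigma,\delta,\varepsilon))$. In coordinates with respect to $\mathcal B(\sigma)$ this is a linear $T$-periodic ODE system $\mathbf a_x=\mathbf A(x;\sigma,\delta,\varepsilon)\mathbf a$; let $\mathbf X$ be its fundamental matrix with $\mathbf X(0)=\mathbf I$. The periodic Evans function is $\Delta(i\sigma+\delta,k;\varepsilon)=\det(e^{ikT}\mathbf I-\mathbf X(T;\sigma,\delta,\varepsilon))$, $k\in\mathbb R$. **Weierstrass polynomial.** $\Delta(i\sigma,k_j(\sigma);0)=0$. If $m$ is the multiplicity of the zero $\lambda=i\sigma$ of $\Delta(\cdot,k_j(\sigma);0)$ (here $m=2$), then for any $p\in\mathbb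 Z$ and $|\delta|,|\gamma|,|\varepsilon|\ll1$ one has $\Delta(i\sigma+\delta,k_j(\sigma)+p\kappa+\gamma;\varepsilon)=W(\delta,\gamma,\varepsilon)h(\delta,\gamma,\varepsilon)$ with $h$ analytic, $h(0,0,0)\ne0$, and $W$ monic of degree $m$ in $\delta$ with coefficients analytic in $(\gamma,\varepsilon)$ and vanishing at $(0,0)$. $W$ is the Weierstrass polynomial associated with the expansion at $(i\sigma,k_j(\sigma)+p\kappa;0)$. *)

(* Defs.v *)
From HB Require Import structures.
From mathcomp Require Import all_boot all_order all_algebra.
From mathcomp Require Import all_classical all_reals all_analysis.
From mathcomp Require Import complex.

Set Implicit Arguments.
Unset Strict Implicit.
Unset Printing Implicit Defensive.

Import Order.TTheory GRing.Theory Num.Theory.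
Import numFieldNormedType.Exports.

Local Open Scope classical_set_scope.
Local Open Scope ring_scope.
Local Open Scope complex_scope.

Notation cabs := ComplexField.Normc.normc.

Section Calculus.
Context {R : realType}.

Definition cosh (x : R) : R := (expR x + expR (- x)) / 2.
Definition sinh (x : R) : R := (expR x - expR (- x)) / 2.
Definition tanh (x : R) : R := sinh x / cosh x.

Definition cis (x : R) : R[i] := cos x +i* sin x.

Definition is_cderive (f : R -> R[i]) (x : R) (l : R[i]) : Prop :=
  is_derive x 1 (fun t => complex.Re (f t)) (complex.Re l) /\
  is_derive x 1 (fun t => complex.Im (f t)) (complex.Im l).

Definition ccontinuous (f : R -> R[i]) : Prop :=
  continuous (fun t => complex.Re (f t)) /\
  continuous (fun t => complex.Im (f t)).

Definition cintegral (D : set R) (f : R -> R[i]) : R[i] :=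
  (\int[lebesgue_measure]_(y in D) complex.Re (f y))
  +i* (\int[lebesgue_measure]_(y in D) complex.Im (f y)).

Definition Dx (f : R -> R -> R) (x y : R) : R := derive1 (fun t => f t y) x.
Definition Dy (f : R -> R -> R) (x y : R) : R := derive1 (f x) y.

Definition partially_derivable (f : R -> R -> R) : Prop :=
  forall x y, derivable (fun t => f t y) x 1 /\ derivable (f x) y 1.

Definition continuous2 (f : R -> R -> R) : Prop :=
  continuous (fun p : R * R => f p.1 p.2).

Definition C2_plane (f : R -> R -> R) : Prop :=
  [/\ partially_derivable f, partially_derivable (Dx f),
      partially_derivable (Dy f)
    & [/\ continuous2 (Dx (Dx f)), continuous2 (Dx (Dy f)),
          continuous2 (Dy (Dx f)) & continuous2 (Dy (Dy f))]].

Definition C2_line (f : R -> R) : Prop :=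
  [/\ forall x, derivable f x 1, forall x, derivable (derive1 f) x 1
    & continuous (derive1 (derive1 f))].

(* [e |-> g e] is real analytic near 0 with values in the bounded functions on
   [D] with the sup norm. *)
Definition analytic_family (I : Type) (D : set I) (g : R -> I -> R) : Prop :=
  exists r M : R, exists c : nat -> I -> R, 0 < r /\
    forall i, D i ->
      (forall n, `|c n i| * r ^+ n <= M) /\
      (forall e, `|e| < r -> series (fun n => c n i * e ^+ n) @ \oo --> g e i).

Definition analytic_at0_2 (f : R -> R -> R[i]) : Prop :=
  exists r M : R, exists c : nat -> nat -> R[i],
  [/\ 0 < r, forall m n, cabs (c m n) * r ^+ (m + n) <= M
    & forall g e : R, `|g| < r -> `|e| < r ->
      cabs (\sum_(m < N) \sum_(n < N) c m n * g%:C ^+ m * e%:C ^+ n - f g e)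
        @[N --> \oo] --> (0 : R)].

Definition analytic_at0_3 (f : R[i] -> R -> R -> R[i]) : Prop :=
  exists r M : R, exists c : nat -> nat -> nat -> R[i],
  [/\ 0 < r, forall l m n, cabs (c l m n) * r ^+ (l + m + n) <= M
    & forall (d : R[i]) (g e : R), cabs d < r -> `|g| < r -> `|e| < r ->
      cabs (\sum_(l < N) \sum_(m < N) \sum_(n < N)
              c l m n * d ^+ l * g%:C ^+ m * e%:C ^+ n - f d g e)
        @[N --> \oo] --> (0 : R)].

End Calculus.

Section Wave.
Context {R : realType}.
Implicit Types (beta kappa : R).

Definition mu0 (k beta : R) : R := k / ((1 + beta * k ^+ 2) * tanh k).

Definition period kappa : R := 2 * pi / kappa.

Definition strip : set (R * R) := [set p | 0 <= p.2 <= 1].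

Section FixedAmplitude.
Variables (phib : R -> R -> R) (etab : R -> R).

Definition ubar (x y : R) : R :=
  Dx phib x y - y * derive1 etab x * Dy phib x y / (1 + etab x).

Definition zbar beta (x : R) : R :=
  beta * derive1 etab x / Num.sqrt (1 + derive1 etab x ^+ 2).

Record wave_equations beta (mu q : R) : Prop := WaveEquations {
  wave_bulk : forall x y, 0 < y < 1 ->
    Dx ubar x y - y * derive1 etab x * Dy ubar x y / (1 + etab x)
    + Dy (Dy phib) x y / (1 + etab x) ^+ 2 = 0;
  wave_bottom : forall x, Dy phib x 0 = 0;
  wave_kinematic : forall x,
    (ubar x 1 - 1) * derive1 etab x - Dy phib x 1 / (1 + etab x) = 0;
  wave_dynamic : forall x,
    mu * derive1 (zbar beta) x + ubar x 1 - ubar x 1 ^+ 2 / 2 - mu * etab x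
    - Dy phib x 1 ^+ 2 / (2 * (1 + etab x) ^+ 2) + q = 0
}.

End FixedAmplitude.

(* The velocity potential is only meaningful for 0 <= y <= 1; it is represented
   by a C^2 extension to the plane, so that its derivatives at y = 0 and y = 1
   are the one-sided ones.  Analyticity in e is that of a map into the space
   C^2(R x [0,1]) x C^2(R) x R x R. *)
Record wave_family beta kappa (e0 : R) (phib : R -> R -> R -> R)
    (etab : R -> R -> R) (mu q : R -> R) : Prop := WaveFamily {
  wave_pos : 0 < e0;
  wave_C2 : forall e, `|e| < e0 -> C2_plane (phib e) /\ C2_line (etab e);
  wave_phib_analytic : forall i j, (i + j <= 2)%N ->
    analytic_family strip
      (fun e p => iter i Dx (iter j Dy (phib e)) p.1 p.2);
  wave_etab_analytic : forall n, (n <= 2)%N ->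
    analytic_family [set: R] (fun e => derive1n n (etab e));
  wave_mu_analytic : analytic_family [set: unit] (fun e _ => mu e);
  wave_q_analytic : analytic_family [set: unit] (fun e _ => q e);
  wave_expansion : exists M : R, forall e, `|e| < e0 ->
    [/\ forall x y, 0 <= y <= 1 ->
          `|phib e x y - e * (sin (kappa * x) * cosh (kappa * y))|
            <= M * e ^+ 2,
        forall x, `|etab e x - e * (sinh kappa * cos (kappa * x))|
            <= M * e ^+ 2,
        `|mu e - mu0 kappa beta| <= M * e ^+ 2
      & `|q e| <= M * e ^+ 2];
  wave_phib_sym : forall e x y, `|e| < e0 -> 0 <= y <= 1 ->
    phib e (- x) y = - phib e x y /\
    phib e (x + period kappa) y = phib e x y;
  wave_etab_sym : forall e x, `|e| < e0 ->
    etab e (- x) = etab e x /\ etab e (x + period kappa) = etab e x;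
  wave_zero_mean : forall e, `|e| < e0 ->
    \int[lebesgue_measure]_(x in `[0, period kappa]) etab e x = 0;
  wave_eqs : forall e, `|e| < e0 ->
    wave_equations (phib e) (etab e) beta (mu e) (q e)
}.

Definition nonresonant beta kappa : Prop :=
  forall k : R, 0 < k -> k != kappa -> mu0 k beta = mu0 kappa beta ->
    ~ exists r : rat, k / kappa = ratr r.

End Wave.

(* Elements of Y = H^1(0,1) x L^2(0,1) x C^2 are represented by tuples
   (varphi, u, eta, z) of functions on R of which only the restriction to [0,1]
   matters, and are identified through [Yeq] below.  An element of
   H^2 x H^1 x C^2 is represented by a tuple
   (varphi, varphi_y, varphi_yy, u, u_y, eta, z) carrying its weak derivatives;
   that they are the weak derivatives is part of [domL]. *)
Definition state (R : realType) : Type :=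
  ((R -> R[i]^o) * (R -> R[i]^o) * R[i]^o * R[i]^o)%type.
Definition jet (R : realType) : Type :=
  ((R -> R[i]^o) * (R -> R[i]^o) * (R -> R[i]^o)
   * (R -> R[i]^o) * (R -> R[i]^o) * R[i]^o * R[i]^o)%type.

HB.instance Definition _ (R : realType) := GRing.Lmodule.copy (state R)
  ((R -> R[i]^o) * (R -> R[i]^o) * R[i]^o * R[i]^o)%type.
HB.instance Definition _ (R : realType) := GRing.Lmodule.copy (jet R)
  ((R -> R[i]^o) * (R -> R[i]^o) * (R -> R[i]^o)
   * (R -> R[i]^o) * (R -> R[i]^o) * R[i]^o * R[i]^o)%type.

Section Spaces.
Context {R : realType}.
Local Notation C := R[i].
Local Notation mu := (@lebesgue_measure R).
Implicit Types (f g : R -> C).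

Definition I01 : set R := `[0, 1].

Definition L2 f : Prop :=
  [/\ measurable_fun I01 (fun y => complex.Re (f y)),
      measurable_fun I01 (fun y => complex.Im (f y))
    & (\int[mu]_(y in I01) (cabs (f y) ^+ 2)%:E < +oo)%E].

(* f is the absolutely continuous representative of an element of H^1(0,1)
   with derivative g *)
Definition weak_derivative f g : Prop :=
  L2 g /\ forall y, 0 <= y <= 1 -> f y = f 0 + cintegral `[0, y] g.

Definition s_phi (U : state R) : R -> C := U.1.1.1.
Definition s_u (U : state R) : R -> C := U.1.1.2.
Definition s_eta (U : state R) : C := U.1.2.
Definition s_z (U : state R) : C := U.2.

Definition j_phi (U : jet R) : R -> C := U.1.1.1.1.1.1.
Definition j_phiy (U : jet R) : R -> C := U.1.1.1.1.1.2.
Definition j_phiyy (U : jet R) : R -> C := U.1.1.1.1.2.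
Definition j_u (U : jet R) : R -> C := U.1.1.1.2.
Definition j_uy (U : jet R) : R -> C := U.1.1.2.
Definition j_eta (U : jet R) : C := U.1.2.
Definition j_z (U : jet R) : C := U.2.

Definition toY (U : jet R) : state R := (j_phi U, j_u U, j_eta U, j_z U).

Definition inY (U : state R) : Prop :=
  (exists g, weak_derivative (s_phi U) g) /\ L2 (s_u U).

Definition Yeq (U V : state R) : Prop :=
  [/\ forall y, 0 <= y <= 1 -> s_phi U y = s_phi V y,
      {ae mu, forall y, 0 <= y <= 1 -> s_u U y = s_u V y},
      s_eta U = s_eta V & s_z U = s_z V].

Definition domL (beta : R) (U : jet R) : Prop :=
  [/\ weak_derivative (j_phi U) (j_phiy U),
      weak_derivative (j_phiy U) (j_phiyy U),
      weak_derivative (j_u U) (j_uy U),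
      j_phiy U 1 + j_z U / beta%:C = 0
    & j_phiy U 0 = 0].

(* Squared norms.  The weak derivative is unique almost everywhere, so the
   infimum ranges over at most one value; it is +oo outside Y. *)
Definition normY2 (U : state R) : \bar R :=
  ereal_inf [set e : \bar R |
    exists2 g, weak_derivative (s_phi U) g &
      e = (\int[mu]_(y in I01)
             (cabs (s_phi U y) ^+ 2 + cabs (g y) ^+ 2
              + cabs (s_u U y) ^+ 2)%:E
           + (cabs (s_eta U) ^+ 2 + cabs (s_z U) ^+ 2)%:E)%E].

Definition normD2 (U : jet R) : \bar R :=
  (\int[mu]_(y in I01)
     (cabs (j_phi U y) ^+ 2 + cabs (j_phiy U y) ^+ 2 + cabs (j_phiyy U y) ^+ 2
      + cabs (j_u U y) ^+ 2 + cabs (j_uy U y) ^+ 2)%:E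
   + (cabs (j_eta U) ^+ 2 + cabs (j_z U) ^+ 2)%:E)%E.

(* continuous and bounded in the graph norm, differentiable in Y *)
Definition bounded_solution (beta : R) (F : R -> jet R -> state R)
    (u : R -> jet R) : Prop :=
  [/\ forall x, domL beta (u x),
      forall x, normD2 (u (x + h) - u x) @[h --> (0 : R)] --> 0%E,
      forall x, normY2 ((h%:C)^-1 *: (toY (u (x + h)) - toY (u x)) - F x (u x))
                  @[h --> (0 : R)^'] --> 0%E
    & exists M : R, forall x, (normD2 (u x) <= M%:E)%E].

End Spaces.

Section Operators.
Context {R : realType}.
Local Notation C := R[i].
Variable beta : R.

Definition opL (mu : R) (lambda : C) (U : jet R) : state R :=
  (fun y => j_u U y - lambda * (y ^+ 2 / (2 * beta))%:C * j_z U,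
   fun y => - j_phiyy U y - lambda * j_eta U,
   j_z U / beta%:C,
   lambda ^+ 2 * j_eta U / (2 * mu)%:C + lambda * j_phi U 1 / mu%:C
     + j_eta U - j_u U 1 / mu%:C).

Section Linearized.
Variables (phib : R -> R -> R) (etab : R -> R) (mu : R).

Definition slope (x : R) : R := Num.sqrt (1 + derive1 etab x ^+ 2) ^+ 3.

(* The substitution
     phi = cV varphi + cU \int_0^y y' u dy' + cE lambda (y^2 / 2) eta. *)
Definition cV (x : R) : R :=
  (1 - ubar phib etab x 1) * (1 + etab x) * slope x.
Definition cU (x : R) : R := derive1 etab x * (1 + etab x).
Definition cE0 (x : R) : R := Dy phib x 1 / (1 + etab x).
Definition cE (lambda : C) (x : R) : C :=
  lambda * (1 + etab x)%:C + (cE0 x)%:C.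
Definition cEx (lambda : C) (x : R) : C :=
  lambda * (derive1 etab x)%:C + (derive1 cE0 x)%:C.

Definition moment (f : R -> C) (y : R) : C :=
  cintegral `[0, y] (fun y' => y'%:C * f y').

Section FixedLambda.
Variable lambda : C.
Variable x : R.
Variable U : jet R.

Definition phi_of (y : R) : C :=
  (cV x)%:C * j_phi U y + (cU x)%:C * moment (j_u U) y
  + cE lambda x * (y ^+ 2 / 2)%:C * j_eta U.

Definition phiy_of (y : R) : C :=
  (cV x)%:C * j_phiy U y + (cU x)%:C * (y%:C * j_u U y)
  + cE lambda x * y%:C * j_eta U.

Definition phiyy_of (y : R) : C :=
  (cV x)%:C * j_phiyy U y + (cU x)%:C * (j_u U y + y%:C * j_uy U y)
  + cE lambda x * j_eta U.

(* phi_x and u_x, solved for in the two linearized equations in 0 < y < 1 *)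
Definition phix_rhs (y : R) : C :=
  (y * derive1 etab x / (1 + etab x))%:C * phiy_of y
  - (y * derive1 etab x * Dy phib x y / (1 + etab x) ^+ 2)%:C * j_eta U
  + (y * Dy phib x y * slope x / (beta * (1 + etab x)))%:C * j_z U
  + j_u U y.

Definition ux_rhs (y : R) : C :=
  (y * derive1 etab x / (1 + etab x))%:C * j_uy U y
  - (y * derive1 etab x * Dy (ubar phib etab) x y / (1 + etab x) ^+ 2)%:C
      * j_eta U
  + (y * Dy (ubar phib etab) x y * slope x / (beta * (1 + etab x)))%:C * j_z U
  - phiyy_of y / ((1 + etab x) ^+ 2)%:C
  + (2 * Dy (Dy phib) x y / (1 + etab x) ^+ 3)%:C * j_eta U.

Definition etax_rhs : C := (slope x / beta)%:C * j_z U.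

Definition zx_rhs : C :=
  (lambda * phi_of 1 - j_u U 1
   + ((ubar phib etab x 1 - 1) * Dy phib x 1 * slope x
        / (beta * (1 + etab x)))%:C * j_z U
   + (Dy phib x 1 * derive1 etab x / (1 + etab x))%:C * j_u U 1
   + (ubar phib etab x 1)%:C * j_u U 1 + mu%:C * j_eta U) / mu%:C.

(* varphi_x, obtained by differentiating the substitution in x *)
Definition varphix_rhs (y : R) : C :=
  (phix_rhs y
   - (derive1 cV x)%:C * j_phi U y
   - (derive1 cU x)%:C * moment (j_u U) y - (cU x)%:C * moment ux_rhs y
   - cEx lambda x * (y ^+ 2 / 2)%:C * j_eta U
   - cE lambda x * (y ^+ 2 / 2)%:C * etax_rhs) / (cV x)%:C.

Definition linearized_rhs : state R :=
  (varphix_rhs, ux_rhs, etax_rhs, zx_rhs).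

End FixedLambda.
End Linearized.
End Operators.

Section Spectrum.
Context {R : realType}.
Local Notation C := R[i].
Variables (beta kappa : R).

Local Notation mu00 := (mu0 kappa beta).
Local Notation L := (opL beta mu00).

Definition Leigenvalue (sigma : R) (nu : C) : Prop :=
  exists U : jet R, [/\ domL beta U, ~ Yeq (toY U) 0
    & Yeq (L (sigma *i) U) (nu *: toY U)].

Fixpoint gen_eigenvector (sigma : R) (nu : C) (n : nat) (U : jet R) : Prop :=
  domL beta U /\
  match n with
  | 0%N => Yeq (toY U) 0
  | n'.+1 => exists V : jet R,
      Yeq (toY V) (L (sigma *i) U - nu *: toY U) /\
      gen_eigenvector sigma nu n' V
  end.

(* an imaginary eigenvalue of algebraic multiplicity at least two *)
Definition critical (sigma : R) : Prop :=
  sigma != 0 /\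
  exists (k : R) (n : nat) (U V : jet R),
    [/\ gen_eigenvector sigma (k *i) n U, gen_eigenvector sigma (k *i) n V
      & forall c d : C, Yeq (c *: toY U + d *: toY V) 0 -> c = 0 /\ d = 0].

Definition resonances (sigma : R) : set (R * R * nat) :=
  [set t | [/\ Leigenvalue sigma (t.1.1 *i), Leigenvalue sigma (t.1.2 *i),
               (1 <= t.2)%N & t.1.1 - t.1.2 = t.2%:R * kappa]].

Definition Ysigma (sigma : R) (V : state R) : Prop :=
  exists m (k : 'I_m -> R) (n : 'I_m -> nat) (U : 'I_m -> jet R),
    (forall i, gen_eigenvector sigma ((k i) *i) (n i) (U i)) /\
    Yeq V (\sum_(i < m) toY (U i)).

Definition combination m (b : 'I_m -> jet R) (a : 'cV[C]_m) : jet R :=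
  \sum_(i < m) a i 0 *: b i.

Definition Ysigma_basis (sigma : R) m (b : 'I_m -> jet R) : Prop :=
  [/\ forall i, exists (k : R) (n : nat), gen_eigenvector sigma (k *i) n (b i),
      forall a, Yeq (toY (combination b a)) 0 -> a = 0
    & forall V, Ysigma sigma V -> exists a, Yeq V (toY (combination b a))].

Record spectral_projection (sigma : R) (P : state R -> state R) : Prop :=
  SpectralProjection {
  proj_eq : forall U V, inY U -> Yeq U V -> Yeq (P U) (P V);
  proj_linear : forall (c : C) U V, inY U -> inY V ->
    Yeq (P (c *: U + V)) (c *: P U + P V);
  proj_bounded : exists M : R, forall U, inY U ->
    (normY2 (P U) <= M%:E * normY2 U)%E;
  proj_range : forall U, inY U -> Ysigma sigma (P U);
  proj_id : forall U, Ysigma sigma U -> Yeq (P U) U;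
  proj_commute : forall U V, domL beta U -> domL beta V ->
    Yeq (toY V) (P (toY U)) -> Yeq (L (sigma *i) V) (P (L (sigma *i) U))
}.

End Spectrum.

Section Evans.
Context {R : realType}.
Local Notation C := R[i].
Variables (beta kappa : R).
Variables (phib : R -> R -> R -> R) (etab : R -> R -> R) (mu : R -> R).

Local Notation L := (opL beta (mu0 kappa beta)).

Definition opB (x : R) (lambda : C) (e : R) (U : jet R) : state R :=
  linearized_rhs beta (phib e) (etab e) (mu e) lambda x U - L lambda U.

Variable sigma : R.

Definition opBsigma (x : R) (d : C) (e : R) (U : jet R) : state R :=
  L (sigma *i + d) U - L (sigma *i) U + opB x (sigma *i + d) e U.

Definition spectral_rhs (d : C) (e : R) (x : R) (U : jet R) : state R :=
  L (sigma *i + d) U + opB x (sigma *i + d) e U.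

Variables (m : nat) (b : 'I_m -> jet R) (P : state R -> state R).
Variable w : C -> R -> R -> jet R -> jet R.

Definition reduced_rhs (d : C) (e : R) (x : R) (v : jet R) : state R :=
  L (sigma *i) v + P (opBsigma x d e (v + w d e x v)).

(* Y(sigma)-valued functions are differentiated in coordinates. *)
Definition bounded_reduced_solution (d : C) (e : R) (a : R -> 'cV[C]_m)
    : Prop :=
  (exists a' : R -> 'cV[C]_m, forall x,
     (forall i, is_cderive (fun t => a t i 0) x (a' x i 0)) /\
     Yeq (toY (combination b (a' x))) (reduced_rhs d e x (combination b (a x))))
  /\ exists M : R, forall x i, cabs (a x i 0) <= M.

(* [red_equiv] says both that v + w(x, v) is a bounded solution when v is
   one, and that every bounded solution is of this form. *)
Record reduction_map (d : C) (e : R) : Prop := ReductionMap {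
  red_dom : forall x a, domL beta (w d e x (combination b a));
  red_ker : forall x a, Yeq (P (toY (w d e x (combination b a)))) 0;
  red_linear : forall x (c : C) a a',
    Yeq (toY (w d e x (combination b (c *: a + a'))))
        (c *: toY (w d e x (combination b a))
         + toY (w d e x (combination b a')));
  red_periodic : forall x a,
    Yeq (toY (w d e (x + period kappa) (combination b a)))
        (toY (w d e x (combination b a)));
  red_equiv : forall u : R -> jet R, (forall x, domL beta (u x)) ->
    (bounded_solution beta (spectral_rhs d e) u <->
     exists2 a, bounded_reduced_solution d e a &
       forall x, let v := combination b (a x) in
         Yeq (toY (u x)) (toY (v + w d e x v)))
}.

Record coordinate_system (d : C) (e : R) (A : R -> 'M[C]_m) : Prop :=
  CoordinateSystem {
  coord_continuous : forall i j, ccontinuous (fun x => A x i j);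
  coord_periodic : forall x, A (x + period kappa) = A x;
  coord_eq : forall x a,
    Yeq (toY (combination b (A x *m a))) (reduced_rhs d e x (combination b a))
}.

End Evans.

Section Weierstrass.
Context {R : realType}.
Local Notation C := R[i].

Definition fundamental_matrix m (A X : R -> 'M[C]_m) : Prop :=
  X 0 = 1%:M /\
  forall x i j, is_cderive (fun t => X t i j) x ((A x *m X x) i j).

(* Delta(i sigma + d, k; e), where X is the fundamental matrix at (d, e) *)
Definition periodic_evans (kappa : R) m (X : C -> R -> R -> 'M[C]_m)
    (d : C) (k : R) (e : R) : C :=
  \det ((cis (k * period kappa))%:M - X d e (period kappa)).

Definition weierstrass2 (a1 a0 : R -> R -> C) (d : C) (g e : R) : C :=
  d ^+ 2 + a1 g e * d + a0 g e.

Definition is_weierstrass2 (Delta : C -> R -> R -> C) (k : R)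
    (a1 a0 : R -> R -> C) : Prop :=
  [/\ analytic_at0_2 a1, analytic_at0_2 a0, a1 0 0 = 0, a0 0 0 = 0
    & exists (h : C -> R -> R -> C) (r : R),
      [/\ 0 < r, analytic_at0_3 h, h 0 0 0 != 0
        & forall (d : C) (g e : R), cabs d < r -> `|g| < r -> `|e| < r ->
            Delta d (k + g) e = weierstrass2 a1 a0 d g e * h d g e]].

Definition disc (a1 a0 : R -> R -> C) (g e : R) : C :=
  a1 g e ^+ 2 - 4 * a0 g e.

(* the two roots, according to the sign b *)
Definition wroot (b : bool) (a1 a0 : R -> R -> C) (g e : R) : C :=
  - a1 g e / 2 + (-1) ^+ b * sqrtc (disc a1 a0 g e) / 2.

End Weierstrass.

(* Main.v *)
Require Import Defs.
From HB Require Import structures.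
From mathcomp Require Import all_boot all_order all_algebra.
From mathcomp Require Import all_classical all_reals all_analysis.
From mathcomp Require Import measurable_realfun complex ring lra.
Set Implicit Arguments.
Unset Strict Implicit.
Unset Printing Implicit Defensive.
Import Order.TTheory GRing.Theory Num.Theory.
Import numFieldNormedType.Exports.
Local Open Scope classical_set_scope.
Local Open Scope ring_scope.
Local Open Scope complex_scope.

(* The equations are real and the wave is reversible (phi is odd and eta is even
   in x), so if U is a bounded solution of the spectral problem at lambda, then
   x |-> srev (U (- x)) is one at - conj lambda with the same real Floquet
   exponent, where srev conjugates U and reverses the signs of varphi and z.  A
   zero of the Evans function at (delta, k) is a Floquet solution of the reduced
   system; Mielke's reduction lifts it to the full system, the symmetry moves it
   to - conj delta, and projecting back yields a zero at (- conj delta, k).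
   Hence for real gamma and epsilon the two roots of the Weierstrass polynomial,
   which tend to 0 with (gamma, epsilon), are permuted by the reflection in the
   imaginary axis: their sum is imaginary and their product is real. *)

(** * Linear ordinary differential equations *)

(** Nothing relates the maps [w] or the matrices [A] at d and at [- conjc d], so no conjugacy of the
    two reduced systems is at hand. Their only link is [red_equiv], which sees bounded solutions of
    the full problem; hence the detour. A real k makes the multiplier [cis (k * T)] unimodular,
    which is used twice: Floquet solutions are bounded, so [red_equiv] applies to them, and the
    inverse multiplier produced by x -> -x is turned back into the original one by conjugation. Only
    zeros of the Evans function are compared, not values or multiplicities; the reflection being an
    involution makes up for this. The Weierstrass factorization holds only near the origin. A
    Lipschitz estimate there, drawn from the coefficient bounds, keeps the roots in that
    neighbourhood and [h] away from zero. The potential is odd only for 0 <= y <= 1, so states are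
    compared pointwise on that interval, and y-derivatives at its endpoints are determined by
    one-sided data. *)

Lemma is_derive_congr {R : realType} (f g : R -> R) (x l k : R) :
  is_derive x 1 f l -> f =1 g -> l = k -> is_derive x 1 g k.
Proof. by move=> h /funext <- <-. Qed.

Section LinearODE.
Context {R : realType} {m : nat}.
Local Notation C := R[i].
Implicit Types (A : R -> 'M[C]_m) (a : R -> 'cV[C]_m).

Definition linear_ode A a : Prop :=
  forall x i, is_cderive (fun t => a t i 0) x ((A x *m a x) i 0).

Definition sqnorm (v : 'cV[C]_m) : R :=
  \sum_i (complex.Re (v i 0) ^+ 2 + complex.Im (v i 0) ^+ 2).

Definition abs_entries (M : 'M[C]_m) : R :=
  \sum_i \sum_j (`|complex.Re (M i j)| + `|complex.Im (M i j)|).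

Lemma sqnorm_ge0 v : 0 <= sqnorm v.
Proof. by apply: sumr_ge0 => i _; rewrite addr_ge0// sqr_ge0. Qed.

Lemma sqnorm_eq0 v : sqnorm v = 0 -> v = 0.
Proof.
move=> /eqP; rewrite psumr_eq0 => [/allP h|i _]; last by rewrite addr_ge0// sqr_ge0.
apply/matrixP => i j; rewrite ord1 mxE.
have := h i; rewrite mem_index_enum => /(_ isT) /=.
rewrite paddr_eq0 ?sqr_ge0// !sqrf_eq0 => /andP[/eqP + /eqP].
by case: (v i 0) => ? ? /= -> ->.
Qed.

Lemma cReM (x y : C) :
  complex.Re (x * y) = complex.Re x * complex.Re y - complex.Im x * complex.Im y.
Proof. by case: x; case: y. Qed.

Lemma cImM (x y : C) :
  complex.Im (x * y) = complex.Re x * complex.Im y + complex.Im x * complex.Re y.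
Proof. by case: x => ? ?; case: y => ? ? /=; rewrite addrC [X in _ + X]mulrC addrC. Qed.

Lemma cReB (x y : C) : complex.Re (x - y) = complex.Re x - complex.Re y.
Proof. by case: x; case: y. Qed.

Lemma cImB (x y : C) : complex.Im (x - y) = complex.Im x - complex.Im y.
Proof. by case: x; case: y. Qed.

Lemma Re_sum (I : Type) (r : seq I) (F : I -> C) :
  complex.Re (\sum_(i <- r) F i) = \sum_(i <- r) complex.Re (F i).
Proof. by apply: (big_morph (@complex.Re R)) => // -[? ?] []. Qed.

Lemma Im_sum (I : Type) (r : seq I) (F : I -> C) :
  complex.Im (\sum_(i <- r) F i) = \sum_(i <- r) complex.Im (F i).
Proof. by apply: (big_morph (@complex.Im R)) => // -[? ?] []. Qed.

Lemma sqnorm_term (v : 'cV[C]_m) i :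
  complex.Re (v i 0) ^+ 2 + complex.Im (v i 0) ^+ 2 <= sqnorm v.
Proof.
rewrite /sqnorm (bigD1 i)//= lerDl sumr_ge0// => j _.
by rewrite addr_ge0// sqr_ge0.
Qed.

Definition sqnorm_deriv (v w : 'cV[C]_m) : R :=
  \sum_i (2 * (complex.Re (v i 0) * complex.Re (w i 0)
               + complex.Im (v i 0) * complex.Im (w i 0))).

(** For the entry r + i s of M at (i, j) the contribution is twice r (p u + q w) + s (q u - p w),
    and each bracket is at most [sqnorm v] by 2 |a b| <= a^2 + b^2. *)
Lemma sqnorm_deriv_le (M : 'M[C]_m) v :
  sqnorm_deriv v (M *m v) <= 2 * abs_entries M * sqnorm v.
Proof.
rewrite /sqnorm_deriv /abs_entries -mulrA [_ * sqnorm v]mulr_suml mulr_sumr.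
apply: ler_sum => i _; have n0 := sqnorm_ge0 v; have hv := sqnorm_term v.
move: (sqnorm v) n0 hv => n n0 hv.
rewrite mxE Re_sum Im_sum !mulr_sumr -big_split /= mulr_sumr mulr_suml mulr_sumr.
apply: ler_sum => j _.
rewrite cReM cImM.
have := hv i; have := hv j.
set p := complex.Re (v i 0); set q := complex.Im (v i 0).
set u := complex.Re (v j 0); set w := complex.Im (v j 0).
set r := complex.Re _; set s := complex.Im _ => h1 h2.
have b1 : `|p * u + q * w| <= n.
  have := sqr_ge0 (p - u); have := sqr_ge0 (p + u).
  have := sqr_ge0 (q - w); have := sqr_ge0 (q + w).
  by rewrite ler_norml; lra.
have b2 : `|q * u - p * w| <= n.
  have := sqr_ge0 (q - u); have := sqr_ge0 (q + u).
  have := sqr_ge0 (p - w); have := sqr_ge0 (p + w).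
  by rewrite ler_norml; lra.
have c1 : r * (p * u + q * w) <= `|r| * n.
  by rewrite (le_trans (ler_norm _))// normrM ler_wpM2l.
have c2 : s * (q * u - p * w) <= `|s| * n.
  by rewrite (le_trans (ler_norm _))// normrM ler_wpM2l.
lra.
Qed.

Lemma is_derive_sqnorm (a a' : R -> 'cV[C]_m) x :
  (forall i, is_cderive (fun t => a t i 0) x (a' x i 0)) ->
  is_derive x 1 (fun t => sqnorm (a t)) (sqnorm_deriv (a x) (a' x)).
Proof.
move=> ha; pose F (i : 'I_m) t := complex.Re (a t i 0) ^+ 2 + complex.Im (a t i 0) ^+ 2.
have dF i : is_derive x 1 (F i) (2 * (complex.Re (a x i 0) * complex.Re (a' x i 0)
               + complex.Im (a x i 0) * complex.Im (a' x i 0))).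
  have [hr hi] := ha i.
  refine (is_derive_congr (is_deriveD (is_deriveX 2 hr) (is_deriveX 2 hi)) _ _) => //.
  by rewrite !expr1 /GRing.scale /=; ring.
by refine (is_derive_congr (is_derive_sum dF) _ _) => // t; rewrite fct_sumE.
Qed.

(** Grönwall's argument: with K twice the maximum of [abs_entries] on [0, x], the weighted norm g is
    nonincreasing there and starts at 0. *)
Lemma linear_ode_forward A a :
  (forall i j, ccontinuous (fun x => A x i j)) ->
  linear_ode A a -> a 0 = 0 -> forall x, 0 <= x -> a x = 0.
Proof.
move=> cA sol a0 x x0.
have cf : continuous (fun t => abs_entries (A t)).
  apply: continuous_big => [|i _]; first exact: add_continuous.
  apply: continuous_big => [|j _ t]; first exact: add_continuous.
  have [cr ci] := cA i j.
  by apply: cvgD; apply: cvg_norm; [exact: cr|exact: ci].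
have [c _ hc] := EVT_max x0 (continuous_subspaceT cf).
set K := 2 * abs_entries (A c).
pose g t := sqnorm (a t) * expR (- K * t).
pose g' t := (sqnorm_deriv (a t) (A t *m a t) - K * sqnorm (a t)) * expR (- K * t).
have dg (t : R) : is_derive t 1 g (g' t).
  have h1 := @is_derive_sqnorm a (fun x => A x *m a x) t (sol t).
  have h2 : is_derive t 1 (fun t : R => expR (- K * t)) (expR (- K * t) * - K).
    apply: (@is_derive1_comp _ expR (fun t => - K * t)).
    by refine (is_derive_congr (is_deriveZ (- K) (is_derive_id t 1)) _ _) => //; exact: mulr1.
  refine (is_derive_congr (is_deriveM h1 h2) _ _) => //.
  by rewrite /g' /GRing.scale /=; ring.
have gx : g x <= g 0.
  apply: (@ler0_derive1_nincr _ g 0 x) => //.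
  - move=> t tx; rewrite derive1E (@derive_val _ _ _ _ _ _ _ (dg t)).
    rewrite /g' pmulr_lle0 ?expR_gt0// subr_le0.
    rewrite (le_trans (sqnorm_deriv_le _ _))// ler_wpM2r ?sqnorm_ge0//.
    rewrite /K ler_pM2l// hc//; move: tx; rewrite !in_itv /= => /andP[? ?].
    by rewrite !ltW.
  - apply: continuous_subspaceT => t; apply: differentiable_continuous.
    apply/derivable1_diffP; exact: (@ex_derive _ _ _ _ _ _ _ (dg t)).
apply: sqnorm_eq0; apply/eqP; rewrite eq_le sqnorm_ge0 andbT.
move: gx; rewrite /g a0 /sqnorm [X in _ <= X * _]big1 ?mul0r.
  by rewrite pmulr_lle0// expR_gt0.
by move=> i _; rewrite mxE /= expr0n /= addr0.
Qed.

Lemma is_cderive_reflect (f : R -> C) x l :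
  is_cderive f (- x) l -> is_cderive (fun t => f (- t)) x (- l).
Proof.
have H (h : R -> R) (k : R) : is_derive (- x) 1 h k -> is_derive x 1 (fun t => h (- t)) (- k).
  move=> dh; refine (is_derive_congr (is_derive1_comp dh (is_deriveNid x 1)) _ _) => //.
  by rewrite mulrN1.
case: l => lr li [hr hi]; split => /=; exact: H.
Qed.

Lemma linear_ode_eq0 A a :
  (forall i j, ccontinuous (fun x => A x i j)) ->
  linear_ode A a -> a 0 = 0 -> forall x, a x = 0.
Proof.
move=> cA sol a0 x; have [|x0] := leP 0 x; first exact: (linear_ode_forward cA sol a0).
(* Reversing time turns the matrix into [- A (- t)], so negative times reduce to positive ones. *)
rewrite -(opprK x); apply: (@linear_ode_forward (fun t => - A (- t)) (fun t => a (- t))).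
- move=> i j; have [cr ci] := cA i j.
  have H (h h' : R -> R) : continuous h -> (forall t, h' t = - h (- t)) -> continuous h'.
    move=> ch hh'; rewrite (_ : h' = fun t => - h (- t)); last exact/funext.
    by move=> t; apply: cvgN; apply: continuous_comp; [exact: opp_continuous|exact: ch].
  by split; [apply: H cr _|apply: H ci _] => t; rewrite mxE; case: (A _ _ _).
- by move=> t i; rewrite mulNmx mxE; exact: (is_cderive_reflect (sol (- t) i)).
- by rewrite oppr0.
- by rewrite oppr_ge0 ltW.
Qed.

Lemma is_cderiveB (f g : R -> C) x l k :
  is_cderive f x l -> is_cderive g x k ->
  is_cderive (fun t => f t - g t) x (l - k).
Proof.
move=> [fr fi] [gr gi]; split.
- by refine (is_derive_congr (is_deriveB fr gr) _ _) => [t|]; rewrite cReB.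
- by refine (is_derive_congr (is_deriveB fi gi) _ _) => [t|]; rewrite cImB.
Qed.

Lemma linear_ode_unique A a a' :
  (forall i j, ccontinuous (fun x => A x i j)) ->
  linear_ode A a -> linear_ode A a' -> a 0 = a' 0 -> forall x, a x = a' x.
Proof.
move=> cA sa sa' h0 x; apply/eqP; rewrite -subr_eq0; apply/eqP.
apply: (@linear_ode_eq0 A (fun t => a t - a' t)) => // [t i|]; last by rewrite h0 subrr.
rewrite mulmxBr !mxE.
rewrite (_ : (fun t => _) = fun t => a t i 0 - a' t i 0); last by apply/funext => ?; rewrite !mxE.
by have := is_cderiveB (sa t i) (sa' t i); rewrite !mxE.
Qed.

Lemma is_cderive_scale (c : C) (f : R -> C) x l :
  is_cderive f x l -> is_cderive (fun t => c * f t) x (c * l).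
Proof.
move=> [fr fi]; split.
- by refine (is_derive_congr (is_deriveB (is_deriveZ (complex.Re c) fr)
    (is_deriveZ (complex.Im c) fi)) _ _) => [t|]; rewrite cReM.
- by refine (is_derive_congr (is_deriveD (is_deriveZ (complex.Re c) fi)
    (is_deriveZ (complex.Im c) fr)) _ _) => [t|]; rewrite cImM.
Qed.

Lemma is_cderive_sum (n : nat) (f : 'I_n -> R -> C) x (l : 'I_n -> C) :
  (forall i, is_cderive (f i) x (l i)) ->
  is_cderive (fun t => \sum_i f i t) x (\sum_i l i).
Proof.
move=> h; split; [rewrite Re_sum|rewrite Im_sum].
- have dr i : is_derive x 1 (fun t => complex.Re (f i t)) (complex.Re (l i)) by have [] := h i.
  by refine (is_derive_congr (is_derive_sum dr) _ _) => // t; rewrite fct_sumE Re_sum.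
- have di i : is_derive x 1 (fun t => complex.Im (f i t)) (complex.Im (l i)) by have [] := h i.
  by refine (is_derive_congr (is_derive_sum di) _ _) => // t; rewrite fct_sumE Im_sum.
Qed.

Lemma linear_ode_fundamental A X (v : 'cV[C]_m) :
  fundamental_matrix A X -> linear_ode A (fun t => X t *m v).
Proof.
move=> [_ dX] x i.
rewrite (_ : (fun t => _) = fun t => \sum_j v j 0 * X t i j); last first.
  by apply/funext => t; rewrite mxE; apply: eq_bigr => j _; rewrite mulrC.
rewrite mulmxA mxE.
under eq_bigr do rewrite mulrC.
by apply: is_cderive_sum => j; apply: is_cderive_scale.
Qed.

Lemma linear_ode_scale A a (c : C) :
  linear_ode A a -> linear_ode A (fun t => c *: a t).
Proof.
move=> sa x i; rewrite -scalemxAr mxE.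
rewrite (_ : (fun t => _) = fun t => c * a t i 0); last by apply/funext => t; rewrite mxE.
exact: is_cderive_scale.
Qed.

Lemma linear_ode_shift A a (T : R) :
  (forall x, A (x + T) = A x) ->
  linear_ode A a -> linear_ode A (fun t => a (t + T)).
Proof.
move=> pA sa x i; rewrite -pA.
have H (h : R -> R) (k : R) : is_derive (x + T) 1 h k -> is_derive x 1 (fun t => h (t + T)) k.
  move=> dh.
  have ds : is_derive x 1 (fun t => t + T) 1.
    by refine (is_derive_congr (is_deriveD (is_derive_id x 1) (is_derive_cst T x 1)) _ _);
      rewrite ?addr0.
  by refine (is_derive_congr (@is_derive1_comp _ h (+%R^~ T) x k 1 dh ds) _ _) => //; rewrite mulr1.
by have [hr hi] := sa (x + T) i; split; exact: H.
Qed.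

End LinearODE.

(** * Weierstrass polynomials of degree two *)

Section PowerSeries.
Context {R : realType}.
Local Notation C := R[i].
Import ComplexField.Normc.

Lemma cabs_ge0 (z : C) : 0 <= cabs z.
Proof. by case: z => a b /=; exact: sqrtr_ge0. Qed.

Lemma cabs_real (x : R) : cabs x%:C = `|x|.
Proof. by rewrite /= expr0n /= addr0 sqrtr_sqr. Qed.

Lemma cabsX (z : C) n : cabs (z ^+ n) = cabs z ^+ n.
Proof. by elim: n => [|n IH]; rewrite ?expr0 ?normc1// !exprS normcM IH. Qed.

Lemma cabsN (z : C) : cabs (- z) = cabs z.
Proof. exact: normcN. Qed.

Lemma cabsD (y z : C) : cabs (y + z) <= cabs y + cabs z.
Proof. exact: le_normcD. Qed.

Lemma cabsJ (z : C) : cabs (conjc z) = cabs z.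
Proof. by case: z => a b /=; rewrite sqrrN. Qed.

Lemma cabs_sum_le (I : finType) (P : pred I) (t : I -> C) (w : I -> R) :
  (forall i, cabs (t i) <= w i) -> cabs (\sum_(i | P i) t i) <= \sum_(i | P i) w i.
Proof.
move=> h; elim/big_ind2: _ => [|x a y b xa yb|//]; first by rewrite normc0.
by rewrite (le_trans (cabsD _ _))// lerD.
Qed.

Lemma cabs_sum_dist (I : finType) (i0 : I) (t : I -> C) (w : I -> R) :
  (forall i, cabs (t i) <= w i) ->
  cabs (\sum_i t i - t i0) <= \sum_i w i - w i0.
Proof.
move=> h; rewrite (bigD1 i0)//= [in leRHS](bigD1 i0)//=.
by rewrite [t i0 + _]addrC addrK [w i0 + _]addrC addrK; exact: cabs_sum_le.
Qed.

(** The bound 1 / (1 - s) <= 1 + 2 s on [0, 1/2] comes from (1 - s) (1 + 2 s) = 1 + s (1 - 2 s). *)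
Lemma geometric_sum_le (s : R) n : 0 <= s <= 1 / 2 ->
  \sum_(i < n) s ^+ i <= 1 + 2 * s.
Proof.
move=> /andP[s0 s1].
have : (1 - s) * (\sum_(i < n) s ^+ i) <= 1.
  have <- : 1 - s ^+ n = (1 - s) * (\sum_(i < n) s ^+ i) by rewrite -[LHS]opprB subrX1 -mulNr opprB.
  by rewrite lerBlDr lerDl exprn_ge0.
move: (\sum_(i < n) _) => S hS.
rewrite -(@ler_pM2l _ (1 - s)); last by lra.
rewrite (le_trans hS)//.
nra.
Qed.

(** The coefficient bound majorizes the terms by M s^(l+m+n), so the sum without its constant term
    is at most M ((1 + 2 s)^3 - 1), and 6 s + 12 s^2 + 8 s^3 <= 14 s for s <= 1/2. The range [N.+1]
    ensures that the constant term is present; the bound is uniform in N. *)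
Lemma cabs_partial_sum_dist3 (c : nat -> nat -> nat -> C) (r M s : R) (d : C) (g e : R) N :
  0 < r -> (forall l m n, cabs (c l m n) * r ^+ (l + m + n) <= M) ->
  0 <= s <= 1 / 2 -> cabs d <= s * r -> `|g| <= s * r -> `|e| <= s * r ->
  cabs (\sum_(l < N.+1) \sum_(m < N.+1) \sum_(n < N.+1)
          c l m n * d ^+ l * g%:C ^+ m * e%:C ^+ n - c 0 0 0) <= 14 * M * s.
Proof.
move=> r0 hc /[dup] hs /andP[s0 s1] hd hg he.
pose t (p : 'I_N.+1 * 'I_N.+1 * 'I_N.+1) : C :=
  c p.1.1 p.1.2 p.2 * d ^+ p.1.1 * g%:C ^+ p.1.2 * e%:C ^+ p.2.
pose w (p : 'I_N.+1 * 'I_N.+1 * 'I_N.+1) : R :=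
  M * s ^+ p.1.1 * s ^+ p.1.2 * s ^+ p.2.
have htw p : cabs (t p) <= w p.
  case: p => -[l m] n; rewrite /t /w /= !normcM !cabsX !cabs_real.
  have hM := hc l m n.
  have cp k (x : R) : 0 <= x -> x <= s * r -> x ^+ k <= s ^+ k * r ^+ k.
    by move=> x0 xs; rewrite -exprMn lerXn2r// nnegrE (le_trans x0).
  rewrite (@le_trans _ _ (cabs (c l m n) * (s ^+ l * r ^+ l) * (s ^+ m * r ^+ m)
      * (s ^+ n * r ^+ n)))//.
    apply: ler_pM; rewrite ?mulr_ge0 ?exprn_ge0 ?normr_ge0 ?cabs_ge0//; last exact: cp.
    apply: ler_pM; rewrite ?mulr_ge0 ?exprn_ge0 ?normr_ge0 ?cabs_ge0//; last exact: cp.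
    by apply: ler_pM; rewrite ?exprn_ge0 ?cabs_ge0//; apply: cp => //; exact: cabs_ge0.
  have -> : cabs (c l m n) * (s ^+ l * r ^+ l) * (s ^+ m * r ^+ m) * (s ^+ n * r ^+ n)
     = cabs (c l m n) * r ^+ (l + m + n) * (s ^+ l * s ^+ m * s ^+ n).
    by rewrite !exprD; ring.
  rewrite -!mulrA [in leRHS]mulrA -!mulrA.
  by rewrite mulrA ler_wpM2r// !mulr_ge0// exprn_ge0.
have := cabs_sum_dist (ord0, ord0, ord0) htw.
have -> : \sum_p t p = \sum_(l < N.+1) \sum_(m < N.+1) \sum_(n < N.+1)
    c l m n * d ^+ l * g%:C ^+ m * e%:C ^+ n.
  by rewrite pair_big pair_big.
have -> : \sum_p w p = M * (\sum_(l < N.+1) s ^+ l) * (\sum_(m < N.+1) s ^+ m)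
    * (\sum_(n < N.+1) s ^+ n).
  rewrite -(pair_big xpredT xpredT (fun i j => w (i, j))) /=.
  rewrite -(pair_big xpredT xpredT (fun i j => \sum_n w (i, j, n))) /= /w /=.
  under eq_bigr do under eq_bigr do rewrite -mulr_sumr.
  under eq_bigr do rewrite -mulr_suml -mulr_sumr.
  by rewrite -!mulr_suml -mulr_sumr.
rewrite /t /w /= !expr0 !mulr1 => /le_trans; apply.
have M0 : 0 <= M by have := hc 0%N 0%N 0%N; rewrite expr0 mulr1; apply: le_trans; exact: cabs_ge0.
have hS := geometric_sum_le N.+1 hs.
have S0 : 0 <= \sum_(i < N.+1) s ^+ i by apply: sumr_ge0 => i _; exact: exprn_ge0.
move: (\sum_(i < N.+1) s ^+ i) hS S0 => S hS S0.
have S3 : S * S * S <= (1 + 2 * s) * (1 + 2 * s) * (1 + 2 * s).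
  by rewrite !ler_pM// mulr_ge0.
have : S * S * S - 1 <= 14 * s by nra.
by move=> /(ler_wpM2l M0); lra.
Qed.

Lemma cabs_dist_limit (f : nat -> C) (l c : C) (b : R) :
  (forall N, cabs (f N.+1 - c) <= b) ->
  cabs (f N - l) @[N --> \oo] --> (0 : R) -> cabs (l - c) <= b.
Proof.
move=> hb fl; apply/ler_addgt0Pr => e e0.
have [N _ hN] := (@cvgr0_norm_lt _ _ _ _ _ _ fl) e e0.
have {}hN := hN N.+1 (leqnSn N); rewrite ger0_norm ?cabs_ge0// in hN.
have -> : l - c = (f N.+1 - c) + - (f N.+1 - l) by ring.
by rewrite (le_trans (cabsD _ _))// cabsN lerD// ltW.
Qed.

Lemma analytic_at0_3_lipschitz (f : C -> R -> R -> C) : analytic_at0_3 f ->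
  exists K r : R, [/\ 0 < K, 0 < r & forall s d g e,
    0 <= s -> s <= r -> cabs d <= s -> `|g| <= s -> `|e| <= s ->
    cabs (f d g e - f 0 0 0) <= K * s].
Proof.
move=> [r [M [c [r0 hc hf]]]].
have near0 s d g e : 0 <= s -> s <= 1 / 2 -> cabs d <= s * r -> `|g| <= s * r ->
    `|e| <= s * r -> cabs (f d g e - c 0 0 0) <= 14 * M * s.
  move=> s0 s1 hd hg he.
  have sr : s * r < r by nra.
  have := hf d g e (le_lt_trans hd sr) (le_lt_trans hg sr) (le_lt_trans he sr).
  apply: cabs_dist_limit => N.
  by apply: (@cabs_partial_sum_dist3 c r M s) => //; rewrite s0.
have M0 : 0 <= M by have := hc 0%N 0%N 0%N; rewrite expr0 mulr1; apply: le_trans; exact: cabs_ge0.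
(* The radius r / 2 keeps s / r at most 1/2, as the geometric estimate requires; the summand 1 keeps
   the constant positive even for M = 0. *)
exists (14 * M / r + 1), (r / 2); split.
- by rewrite ltr_wpDl// divr_ge0 ?mulr_ge0// ltW.
- by rewrite divr_gt0.
move=> s d g e s0 s1 hd hg he.
have sE : s / r * r = s by rewrite divfK// gt_eqF.
have h1 : cabs (f d g e - c 0 0 0) <= 14 * M * (s / r).
  apply: near0; rewrite ?sE ?divr_ge0//; first exact: ltW.
  by rewrite ler_pdivrMr// mulrC mulrA mulr1.
(* At s = 0 the estimate says that [f 0 0 0] is the constant coefficient. *)
have h2 : cabs (f 0 0 0 - c 0 0 0) <= 14 * M * 0.
  by apply: near0; rewrite ?mul0r ?normr0 ?normc0//; lra.
have -> : f d g e - f 0 0 0 = (f d g e - c 0 0 0) - (f 0 0 0 - c 0 0 0) by ring.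
rewrite (le_trans (cabsD _ _))// cabsN.
rewrite mulrDl mul1r; apply: lerD.
  by rewrite (le_trans h1)// mulrA mulrAC.
by rewrite (le_trans h2)// mulr0.
Qed.

(** Placing the coefficients on the slice l = 0 lets the three-variable estimate serve [a1] and [a0]
    as well as [h]. *)
Lemma analytic_at0_2_lift (f : R -> R -> C) :
  analytic_at0_2 f -> analytic_at0_3 (fun=> f).
Proof.
move=> [r [M [c [r0 hc hf]]]].
have M0 : 0 <= M by have := hc 0%N 0%N; rewrite expr0 mulr1; apply: le_trans; exact: cabs_ge0.
exists r, M, (fun l m n => if l == 0%N then c m n else 0); split => //.
  by move=> [|l] m n; [exact: hc|rewrite normc0 mul0r].
move=> d g e hd hg he; have := hf g e hg he.
have H (u v : nat -> R) : (forall N, u N.+1 = v N.+1) -> u @ \oo --> (0 : R) -> v @ \oo --> (0 : R).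
  move=> uv; apply: cvg_trans; apply: near_eq_cvg.
  by exists 1%N => // -[//|N] _; rewrite /= uv.
apply: H => N; congr (cabs (_ - _)); rewrite [RHS]big_ord_recl [X in _ = _ + X]big1 => [|l _].
  by rewrite addr0 expr0; do 2 apply: eq_bigr => ? _; rewrite /= mulr1.
by rewrite big1// => m _; rewrite big1// => n _; rewrite /= !mul0r.
Qed.

Lemma analytic_at0_2_small (f : R -> R -> C) (eta : R) :
  analytic_at0_2 f -> f 0 0 = 0 -> 0 < eta ->
  exists2 r : R, 0 < r & forall g e, `|g| < r -> `|e| < r -> cabs (f g e) <= eta.
Proof.
move=> /analytic_at0_2_lift/analytic_at0_3_lipschitz[K [r [K0 r0 h]]] f0 eta0.
set m := Num.min r (eta / K).
have m0 : 0 < m by rewrite lt_min r0 divr_gt0.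
exists m => // g e hg he.
have := h m 0 g e (ltW m0); rewrite f0 subr0 normc0 => /(_ _ _ _ _)/le_trans; apply.
- by rewrite ge_min lexx.
- exact: ltW.
- exact: ltW.
- exact: ltW.
- by rewrite mulrC -ler_pdivlMr// ge_min lexx orbT.
Qed.

Lemma analytic_at0_3_neq0 (f : C -> R -> R -> C) :
  analytic_at0_3 f -> f 0 0 0 != 0 ->
  exists2 r : R, 0 < r & forall d g e, cabs d < r -> `|g| < r -> `|e| < r -> f d g e != 0.
Proof.
move=> /analytic_at0_3_lipschitz[K [r [K0 r0 h]]] f0.
have a0 : 0 < cabs (f 0 0 0).
  rewrite lt_neqAle cabs_ge0 andbT eq_sym.
  by apply: contra_neq f0 => /eq0_normc.
(* Within this radius f moves by at most half of [cabs (f 0 0 0)], so it cannot reach 0. *)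
set m := Num.min r (cabs (f 0 0 0) / (2 * K)).
have m0 : 0 < m by rewrite lt_min r0 divr_gt0// mulr_gt0.
exists m => // d g e hd hg he; apply/eqP => fz.
have : cabs (f d g e - f 0 0 0) <= K * m.
  by apply: h; [exact: ltW|rewrite ge_min lexx|exact: ltW|exact: ltW|exact: ltW].
rewrite fz sub0r cabsN; apply/negP; rewrite -ltNge.
have : m * (2 * K) <= cabs (f 0 0 0).
  by rewrite -ler_pdivlMr ?mulr_gt0// ge_min lexx orbT.
have := mulr_gt0 K0 m0; lra.
Qed.

End PowerSeries.

(** * Roots of a monic complex quadratic and the sign of its discriminant *)

Section Quadratic.
Context {R : realType}.
Local Notation C := R[i].
Import ComplexField.Normc.

(** A root with |d| >= rho would satisfy |d|^2 <= |b| |d| + |c| <= |d|^2 / 4 + |d|^2 / 4. *)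
Lemma quadratic_root_small (b c d : C) (rho : R) : 0 < rho ->
  cabs b <= rho / 4 -> cabs c <= rho ^+ 2 / 4 -> d ^+ 2 + b * d + c = 0 ->
  cabs d < rho.
Proof.
move=> rho0 hb hc /eqP; rewrite -addrA addr_eq0 => /eqP hd.
have : cabs d ^+ 2 <= cabs b * cabs d + cabs c.
  by rewrite -cabsX hd cabsN -normcM cabsD.
rewrite ltNge => h; apply/negP => hr.
have := cabs_ge0 d; have := cabs_ge0 b; nra.
Qed.

Lemma wroot_factor (a1 a0 : R -> R -> C) d g e :
  weierstrass2 a1 a0 d g e = (d - wroot false a1 a0 g e) * (d - wroot true a1 a0 g e).
Proof.
rewrite /weierstrass2 /wroot expr0 expr1 mul1r.
have : a0 g e = (a1 g e ^+ 2 - disc a1 a0 g e) / 4 by rewrite /disc; field.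
by rewrite -{1}(sqr_sqrtc (disc a1 a0 g e)); move: (sqrtc _) => s ->; field.
Qed.

Lemma wrootP (a1 a0 : R -> R -> C) d g e :
  weierstrass2 a1 a0 d g e = 0 <->
  d = wroot false a1 a0 g e \/ d = wroot true a1 a0 g e.
Proof.
rewrite wroot_factor; split => [/eqP|[]->]; rewrite ?subrr ?mul0r ?mulr0//.
by rewrite mulf_eq0 !subr_eq0 => /orP[]/eqP; [left|right].
Qed.

(* The map d |-> - conjc d is an involution, so it either fixes both roots or
   exchanges them. *)
Lemma symmetric_quadratic (a1 a0 : R -> R -> C) g e :
  (forall d, weierstrass2 a1 a0 d g e = 0 -> weierstrass2 a1 a0 (- conjc d) g e = 0) ->
  complex.Re (a1 g e) = 0 /\ complex.Im (a0 g e) = 0.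
Proof.
set d1 := wroot false a1 a0 g e; set d2 := wroot true a1 a0 g e => h.
have a1E : a1 g e = - (d1 + d2).
  by rewrite /d1 /d2 /wroot expr0 expr1; field.
have a0E : a0 g e = d1 * d2.
  by have := wroot_factor a1 a0 0 g e; rewrite /weierstrass2 -/d1 -/d2 expr2 !mulr0 !add0r => ->; ring.
have s1 : - conjc d1 = d1 \/ - conjc d1 = d2 by apply/wrootP/h/wrootP; left.
have s2 : - conjc d2 = d1 \/ - conjc d2 = d2 by apply/wrootP/h/wrootP; right.
rewrite a1E a0E; clearbody d1 d2; clear -s1 s2.
(* In coordinates [- conjc] is (x, y) -> (- x, y). Exchanged roots are x + i y and - x + i y, with
   sum 2 i y and product - x^2 - y^2; if [d1] is fixed, both real parts vanish. *)
case: d1 d2 s1 s2 => [x1 y1] [x2 y2] /= [[h1 _]|[<- <-] _]; last by split; ring.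
have -> : x1 = 0 by lra.
case=> -[h2 _]; have -> : x2 = 0 by lra.
all: by split; ring.
Qed.

Lemma Re_half (z : C) : complex.Re (z / 2) = complex.Re z / 2.
Proof.
rewrite (_ : 2 = (2 : R)%:C); last by rewrite rmorph_nat.
by rewrite -fmorphV cReM /= mulr0 subr0.
Qed.

Lemma disc_real (a1 a0 : R -> R -> C) g e :
  complex.Re (a1 g e) = 0 -> complex.Im (a0 g e) = 0 ->
  complex.Im (disc a1 a0 g e) = 0.
Proof.
rewrite /disc cImB expr2 !cImM => -> ->.
rewrite (_ : 4 = (4 : R)%:C); last by rewrite rmorph_nat.
by rewrite /=; ring.
Qed.

Lemma Re_wroot (s : bool) (a1 a0 : R -> R -> C) g e :
  complex.Re (a1 g e) = 0 ->
  complex.Re (wroot s a1 a0 g e)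
  = (-1) ^+ s * complex.Re (sqrtc (disc a1 a0 g e)) / 2.
Proof.
move=> h.
have -> : wroot s a1 a0 g e = (- a1 g e - (-1) ^+ (~~ s) * sqrtc (disc a1 a0 g e)) / 2.
  by rewrite /wroot; case: s; rewrite /= ?expr0 ?expr1; field.
rewrite Re_half cReB -[- a1 g e]sub0r cReB h.
by case: s; rewrite /= !expr0 !expr1 ?mulN1r ?mul1r; case: (sqrtc _) => /= ? ?; ring.
Qed.

(** Write [sqrtc z] as x + i y: then x y = 0 and Re z = x^2 - y^2, whatever branch of the root is
    taken, so x vanishes exactly when Re z <= 0. *)
Lemma Re_sqrtc_real (z : C) : complex.Im z = 0 ->
  (complex.Re z <= 0 -> complex.Re (sqrtc z) = 0) /\
  (0 < complex.Re z -> complex.Re (sqrtc z) != 0).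
Proof.
move=> hz; have h := sqr_sqrtc z.
move: hz; rewrite -{1 2 4}h expr2 cReM cImM.
move: (complex.Re _) (complex.Im _) => x y xy; split => [xy1|xy1]; last first.
  by apply/eqP => x0; move: xy1; rewrite x0; nra.
have : x * y = 0 by lra.
by move=> /eqP; rewrite mulf_eq0 => /orP[/eqP//|/eqP y0]; move: xy1; rewrite y0; nra.
Qed.

(** Below modulus [rho] the factorization holds, the symmetry is available and h has no zero, so
    [Delta] and the polynomial have the same zeros. The thresholds rho / 4 and rho^2 / 4 force every
    root of the polynomial into this region, and [- conjc] preserves the modulus. *)
Lemma weierstrass_symmetric (Delta : C -> R -> R -> C) (k r0 : R)
    (a1 a0 : R -> R -> C) : 0 < r0 ->
  (forall d k e, cabs d < r0 -> `|e| < r0 -> Delta d k e = 0 ->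
     Delta (- conjc d) k e = 0) ->
  is_weierstrass2 Delta k a1 a0 ->
  exists2 r : R, 0 < r & forall g e, `|g| < r -> `|e| < r ->
    complex.Re (a1 g e) = 0 /\ complex.Im (a0 g e) = 0.
Proof.
move=> r00 hD [an1 an0 a10 a00 [h [r [rgt0 hh h0 hW]]]].
have [r1 r10 hne] := analytic_at0_3_neq0 hh h0.
set rho := Num.min r0 (Num.min r r1).
have rho0 : 0 < rho by rewrite !lt_min r00 rgt0.
have rhoP : forall x, x < rho -> [/\ x < r0, x < r & x < r1].
  by move=> x; rewrite !lt_min => /and3P[].
clearbody rho.
have [r2 r20 h2] := analytic_at0_2_small (eta := rho / 4) an1 a10 ltac:(lra).
have [r3 r30 h3] := analytic_at0_2_small (eta := rho ^+ 2 / 4) an0 a00 ltac:(nra).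
exists (Num.min rho (Num.min r2 r3)); first by rewrite !lt_min rho0 r20.
move=> g e; rewrite !lt_min => /andP[/rhoP[g0 gr g1] /andP[g2 g3]].
move=> /andP[/rhoP[e0 er e1] /andP[e2 e3]].
apply: symmetric_quadratic => d hd.
have /rhoP[d0 dr d1] : cabs d < rho.
  by apply: quadratic_root_small (h2 g e _ _) (h3 g e _ _) hd.
have Nd : cabs (- conjc d) = cabs d by rewrite cabsN cabsJ.
have : Delta (- conjc d) (k + g) e = 0.
  by apply: hD => //; rewrite hW// hd mul0r.
rewrite hW ?Nd// => /eqP; rewrite mulf_eq0 (negPf (hne _ _ _ _ _ _)) ?Nd// orbF.
by move=> /eqP.
Qed.

End Quadratic.

(** * Complex-valued square-integrable functions *)

Section ComplexIntegral.
Context {R : realType}.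
Local Notation C := R[i].
Local Notation mu := (@lebesgue_measure R).
Implicit Types (D : set R) (f g : R -> C).

Lemma cReD (x y : C) : complex.Re (x + y) = complex.Re x + complex.Re y.
Proof. by case: x; case: y. Qed.

Lemma cImD (x y : C) : complex.Im (x + y) = complex.Im x + complex.Im y.
Proof. by case: x; case: y. Qed.

Lemma cReN (x : C) : complex.Re (- x) = - complex.Re x.
Proof. by case: x. Qed.

Lemma cImN (x : C) : complex.Im (- x) = - complex.Im x.
Proof. by case: x. Qed.

Lemma cReJ (x : C) : complex.Re (conjc x) = complex.Re x.
Proof. by case: x. Qed.

Lemma cImJ (x : C) : complex.Im (conjc x) = - complex.Im x.
Proof. by case: x. Qed.

Lemma sqr_cabs (z : C) : cabs z ^+ 2 = complex.Re z ^+ 2 + complex.Im z ^+ 2.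
Proof. by case: z => a b; rewrite /= sqr_sqrtr// addr_ge0// sqr_ge0. Qed.

(* Unconditional: an undefined integral has value 0. *)
Lemma RintegralN D (f : R -> R) :
  \int[mu]_(x in D) (- f x) = - \int[mu]_(x in D) f x.
Proof.
rewrite /Rintegral integralE [in RHS]integralE.
have -> : ((fun x => (- f x)%:E)^\+ = (EFin \o f)^\-)%E by rewrite -funeposN.
have -> : ((fun x => (- f x)%:E)^\- = (EFin \o f)^\+)%E by rewrite -funenegN.
have : (0 <= \int[mu]_(x in D) ((EFin \o f)^\+ x))%E by exact: integral_ge0.
have : (0 <= \int[mu]_(x in D) ((EFin \o f)^\- x))%E by exact: integral_ge0.
move: (\int[mu]_(x in D) _)%E => b; move: (\int[mu]_(x in D) _)%E => a.
by case: a => [a||]; case: b => [b||]//= _ _; rewrite ?oppr0 ?opprB.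
Qed.

Lemma eq_cintegral D f g : {in D, f =1 g} -> cintegral D f = cintegral D g.
Proof.
by move=> fg; congr (_ +i* _); apply: eq_Rintegral => x xD; rewrite fg.
Qed.

Lemma cintegralJ D f : cintegral D (fun y => conjc (f y)) = (conjc (cintegral D f)).
Proof.
congr (_ +i* _); first by apply: eq_Rintegral => x _; rewrite cReJ.
by rewrite -RintegralN; apply: eq_Rintegral => x _; rewrite cImJ.
Qed.

Lemma cintegralN D f : cintegral D (fun y => - f y) = - cintegral D f.
Proof.
by congr (_ +i* _); rewrite -RintegralN; apply: eq_Rintegral => x _; rewrite ?cReN ?cImN.
Qed.

Let mI : measurable (@I01 R). Proof. exact: measurable_itv. Qed.

Lemma L2P f : L2 f <-> [/\ measurable_fun I01 (fun y => complex.Re (f y)),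
      measurable_fun I01 (fun y => complex.Im (f y)) &
      mu.-integrable I01 (fun y => (cabs (f y) ^+ 2)%:E)].
Proof.
split=> -[mr mi h]; split => //.
  apply/integrableP; split.
    apply/measurable_EFinP; under eq_fun do rewrite sqr_cabs.
    by apply: measurable_funD; exact: measurable_funX.
  by under eq_integral do rewrite gee0_abs ?lee_fin ?exprn_ge0 ?cabs_ge0//.
move/integrableP : h => [_].
by under eq_integral do rewrite gee0_abs ?lee_fin ?exprn_ge0 ?cabs_ge0//.
Qed.

Lemma L2J f : L2 f -> L2 (fun y => conjc (f y)).
Proof.
move=> [mr mi h]; split.
- by under eq_fun do rewrite cReJ.
- by under eq_fun do rewrite cImJ; exact: measurableT_comp.
- by under eq_integral do rewrite cabsJ.
Qed.

Lemma L2N f : L2 f -> L2 (fun y => - f y).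
Proof.
move=> [mr mi h]; split.
- by under eq_fun do rewrite cReN; exact: measurableT_comp.
- by under eq_fun do rewrite cImN; exact: measurableT_comp.
- by under eq_integral do rewrite cabsN.
Qed.

Lemma L2_lin (c : C) f g : L2 f -> L2 g -> L2 (fun y => c * f y + g y).
Proof.
move=> /L2P[fr fi fint] /L2P[gr gi gint]; apply/L2P.
have mr : measurable_fun I01 (fun y => complex.Re (c * f y + g y)).
  under eq_fun do rewrite cReD cReM.
  by apply: measurable_funD => //; apply: measurable_funB; apply: measurable_funM.
have mi : measurable_fun I01 (fun y => complex.Im (c * f y + g y)).
  under eq_fun do rewrite cImD cImM.
  by apply: measurable_funD => //; apply: measurable_funD; apply: measurable_funM.
split => //.
apply: (@le_integrable _ _ _ mu I01 mI _ (fun y =>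
   (2 * cabs c ^+ 2)%:E * (cabs (f y) ^+ 2)%:E + 2%:E * (cabs (g y) ^+ 2)%:E)%E).
- apply/measurable_EFinP; under eq_fun do rewrite sqr_cabs.
  by apply: measurable_funD; exact: measurable_funX.
- move=> y _; rewrite -!EFinM -EFinD lee_fin.
  rewrite ger0_norm ?exprn_ge0 ?cabs_ge0//.
  apply: le_trans (ler_norm _).
  have h : cabs (c * f y + g y) <= cabs c * cabs (f y) + cabs (g y).
    by rewrite (le_trans (cabsD _ _))// ComplexField.Normc.normcM.
  have {h} : cabs (c * f y + g y) ^+ 2 <= (cabs c * cabs (f y) + cabs (g y)) ^+ 2.
    by rewrite lerXn2r// nnegrE ?cabs_ge0// addr_ge0 ?mulr_ge0 ?cabs_ge0.
  have := sqr_ge0 (cabs c * cabs (f y) - cabs (g y)).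
  by nra.
- by apply: integrableD => //; apply: integrableZl.
Qed.

(** Constants are integrable on an interval of finite length, and |t| <= 1 + t^2 gives the
    domination. *)
Lemma L2_integrable f : L2 f ->
  mu.-integrable I01 (EFin \o (fun y => complex.Re (f y))) /\
  mu.-integrable I01 (EFin \o (fun y => complex.Im (f y))).
Proof.
move=> /L2P[fr fi fint].
have i1 : mu.-integrable I01 (fun y => 1%:E + (cabs (f y) ^+ 2)%:E)%E.
  apply: integrableD => //; apply/integrableP; split; first exact: measurable_cst.
  rewrite integral_cst//= normr1 mul1e.
  by rewrite lebesgue_measure_itv/= lte_fin ltr01 ltry.
have bnd (a b c : R) : c ^+ 2 = a ^+ 2 + b ^+ 2 -> `|a| <= `|1 + c ^+ 2| /\ `|b| <= `|1 + c ^+ 2|.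
  move=> h; rewrite [`|1 + _|]ger0_norm ?addr_ge0 ?sqr_ge0// h.
  have := real_normK (num_real a); have := real_normK (num_real b).
  by split; nra.
split; apply: le_integrable i1 => //; try exact/measurable_EFinP.
- by move=> y _; rewrite /= lee_fin; have [] := bnd _ _ _ (sqr_cabs (f y)).
- by move=> y _; rewrite /= lee_fin; have [] := bnd _ _ _ (sqr_cabs (f y)).
Qed.

Lemma itv0y_sub_I01 (y : R) : y <= 1 -> `[0, y] `<=` I01.
Proof.
by move=> y1 z; rewrite /I01 /= !in_itv /= => /andP[-> zy]; rewrite (le_trans zy).
Qed.

(** Unlike negation and conjugation, additivity may fail when an undefined integral takes its
    default value; square integrability rules this out. *)
Lemma cintegral_lin (c : C) f g y : 0 <= y <= 1 -> L2 f -> L2 g ->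
  cintegral `[0, y] (fun t => c * f t + g t)
  = c * cintegral `[0, y] f + cintegral `[0, y] g.
Proof.
move=> /andP[_ y1] /L2_integrable[fr fi] /L2_integrable[gr gi].
have S h : mu.-integrable I01 (EFin \o h) -> mu.-integrable `[0, y] (EFin \o h).
  by apply: integrableS => //; exact: itv0y_sub_I01.
move: fr fi gr gi => /S fr /S fi /S gr /S gi.
have Z (a : R) h : mu.-integrable `[0, y] (EFin \o h) ->
    mu.-integrable `[0, y] (EFin \o (fun t => a * h t)).
  by move=> ih; exact: (integrableZl _ a ih).
apply/eqP; rewrite eq_complex cReD cImD cReM cImM /=; apply/andP; split; apply/eqP.
- under eq_Rintegral do rewrite cReD cReM.
  rewrite RintegralD//; last by apply: (integrableB _ (Z _ _ fr) (Z _ _ fi)).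
  by rewrite RintegralB ?RintegralZl//; exact: Z.
- under eq_Rintegral do rewrite cImD cImM.
  rewrite RintegralD//; last by apply: (integrableD _ (Z _ _ fi) (Z _ _ fr)).
  by rewrite RintegralD ?RintegralZl//; exact: Z.
Qed.

Lemma weak_derivative_lin (c : C) f1 g1 f2 g2 :
  weak_derivative f1 g1 -> weak_derivative f2 g2 ->
  weak_derivative (fun y => c * f1 y + f2 y) (fun y => c * g1 y + g2 y).
Proof.
move=> [l1 h1] [l2 h2]; split; first exact: L2_lin.
by move=> y y01; rewrite h1// h2// cintegral_lin//; ring.
Qed.

Lemma weak_derivativeJ f g :
  weak_derivative f g -> weak_derivative (fun y => conjc (f y)) (fun y => conjc (g y)).
Proof.
move=> [l h]; split; first exact: L2J.
by move=> y y01; rewrite h// cintegralJ rmorphD.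
Qed.

Lemma weak_derivativeN f g :
  weak_derivative f g -> weak_derivative (fun y => - f y) (fun y => - g y).
Proof.
move=> [l h]; split; first exact: L2N.
by move=> y y01; rewrite h// cintegralN opprD.
Qed.

Lemma eq_weak_derivative f1 f2 g : (forall y, 0 <= y <= 1 -> f1 y = f2 y) ->
  weak_derivative f1 g -> weak_derivative f2 g.
Proof.
move=> h [l h1]; split => // y y01; rewrite -!h ?lexx ?ler01//; exact: h1.
Qed.

Lemma primitive_bounded (f g : R -> R) (a : R) : mu.-integrable I01 (EFin \o g) ->
  (forall y, 0 <= y <= 1 -> f y = a + \int[mu]_(t in `[0, y]) g t) ->
  measurable_fun I01 f /\ exists M, forall y, 0 <= y <= 1 -> `|f y| <= M.
Proof.
move=> ig hf.
have cg := parameterized_integral_continuous ler01 ig.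
pose F y := a + parameterized_integral mu 0 y g.
have cF : {within I01, continuous F}.
  by move=> y; apply: cvgD; [exact: cvg_cst|exact: cg].
have fF : {in I01, F =1 f} by move=> y; rewrite inE /I01 /= in_itv /= => /hf ->.
split.
  apply: eq_measurable_fun fF _.
  exact: subspace_continuous_measurable_fun.
have cN : {within I01, continuous (fun y => `|F y|)}.
  by move=> y; apply: cvg_norm; exact: cF.
have [c _ hc] := EVT_max ler01 cN.
exists `|F c| => y y01; rewrite -fF; first by apply: hc; rewrite in_itv.
by rewrite inE /I01 /= in_itv.
Qed.

(** The inclusion of H^1 in L^2: real and imaginary parts are primitives, hence continuous and
    bounded on [0, 1]. [domL] records square integrability of the derivatives only, whereas [inY]
    asks it of u itself. *)
Lemma weak_derivative_L2 f g : weak_derivative f g -> L2 f.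
Proof.
move=> [/L2_integrable[gr gi] h].
have [|mr [Mr hr]] := @primitive_bounded (fun y => complex.Re (f y)) _ (complex.Re (f 0)) gr.
  by move=> y y01; rewrite h// cReD.
have [|mi [Mi hi]] := @primitive_bounded (fun y => complex.Im (f y)) _ (complex.Im (f 0)) gi.
  by move=> y y01; rewrite h// cImD.
split => //.
apply: (@le_lt_trans _ _ (\int[mu]_(y in I01) (Mr ^+ 2 + Mi ^+ 2)%:E)%E).
  apply: ge0_le_integral => //.
  - by move=> y _; rewrite lee_fin exprn_ge0// cabs_ge0.
  - apply/measurable_EFinP; under eq_fun do rewrite sqr_cabs.
    by apply: measurable_funD; exact: measurable_funX.
  - move=> y; rewrite /I01 /= in_itv /= => y01; rewrite lee_fin sqr_cabs lerD//.
    + by rewrite -real_normK ?num_real// lerXn2r ?nnegrE ?hr// (le_trans _ (hr y y01)).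
    + by rewrite -real_normK ?num_real// lerXn2r ?nnegrE ?hi// (le_trans _ (hi y y01)).
rewrite integral_cst//=.
by rewrite lebesgue_measure_itv/= lte_fin ltr01 -EFinB -EFinM ltry.
Qed.

End ComplexIntegral.

(** * Reversibility on states *)

Section States.
Context {R : realType}.
Local Notation C := R[i].
Local Notation mu := (@lebesgue_measure R).
Implicit Types (U V W : state R) (J K : jet R).

#[local] Instance ae_nbhs_filter : Filter (nbhs (almost_everywhere mu)) :=
  ae_filter_ringOfSetsType mu.

Lemma Yeq_refl U : Yeq U U.
Proof. by split => //; exact: aeW. Qed.

Lemma Yeq_sym U V : Yeq U V -> Yeq V U.
Proof.
move=> [h1 h2 h3 h4]; split => //; first by move=> y hy; rewrite h1.
by apply: filterS h2 => y h hy; rewrite h.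
Qed.

Lemma Yeq_trans V U W : Yeq U V -> Yeq V W -> Yeq U W.
Proof.
move=> [a1 a2 a3 a4] [b1 b2 b3 b4]; split => //; last 2 first.
- by rewrite a3.
- by rewrite a4.
- by move=> y hy; rewrite a1// b1.
- by apply: filterS2 a2 b2 => y ha hb hy; rewrite ha// hb.
Qed.

Lemma Yeq_lin (c : C) U1 U2 V1 V2 :
  Yeq U1 U2 -> Yeq V1 V2 -> Yeq (c *: U1 + V1) (c *: U2 + V2).
Proof.
move=> [a1 a2 a3 a4] [b1 b2 b3 b4]; split.
- by move=> y hy; rewrite /s_phi /= !fctE -/(s_phi _) a1// -/(s_phi _) b1.
- by apply: filterS2 a2 b2 => y ha hb hy; rewrite /s_u /= !fctE -/(s_u _) ha// -/(s_u _) hb.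
- by rewrite /s_eta /= -/(s_eta _) a3 -/(s_eta _) b3.
- by rewrite /s_z /= -/(s_z _) a4 -/(s_z _) b4.
Qed.

Lemma YeqD U1 U2 V1 V2 : Yeq U1 U2 -> Yeq V1 V2 -> Yeq (U1 + V1) (U2 + V2).
Proof. by move=> h k; have := Yeq_lin 1 h k; rewrite !scale1r. Qed.

Lemma YeqZ (c : C) U V : Yeq U V -> Yeq (c *: U) (c *: V).
Proof. by move=> h; have := Yeq_lin c h (Yeq_refl 0); rewrite !addr0. Qed.

(* Reversibility composed with complex conjugation; the velocity potential and
   the slope are odd, the horizontal velocity and the elevation are even. *)
Definition srev U : state R :=
  (fun y => - conjc (s_phi U y), fun y => conjc (s_u U y), conjc (s_eta U), - conjc (s_z U)).

Definition jrev J : jet R :=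
  (fun y => - conjc (j_phi J y), fun y => - conjc (j_phiy J y),
   fun y => - conjc (j_phiyy J y), fun y => conjc (j_u J y), fun y => conjc (j_uy J y),
   conjc (j_eta J), - conjc (j_z J)).

Lemma toY_jrev J : toY (jrev J) = srev (toY J). Proof. by []. Qed.

Lemma srev_lin (c : C) U V : srev (c *: U + V) = (conjc c) *: srev U + srev V.
Proof.
case: U => [[[p u] e] z]; case: V => [[[p' u'] e'] z'].
rewrite /srev /s_phi /s_u /s_eta /s_z /=.
congr (_, _, _, _).
- by apply/funext => y; rewrite /= !fctE rmorphD rmorphM opprD -mulrN.
- by apply/funext => y; rewrite /= !fctE rmorphD rmorphM.
- by rewrite rmorphD rmorphM.
- by rewrite rmorphD rmorphM opprD -mulrN.
Qed.

Lemma srevB U V : srev (U - V) = srev U - srev V.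
Proof.
have -> : U - V = (-1) *: V + U by rewrite scaleN1r addrC.
by rewrite srev_lin rmorphN rmorph1 scaleN1r addrC.
Qed.

Lemma srevZ (c : C) U : srev (c *: U) = (conjc c) *: srev U.
Proof.
have srev0 : srev 0 = 0 by rewrite -{1}(subrr (0 : state R)) srevB subrr.
by rewrite -[c *: U]addr0 srev_lin srev0 addr0.
Qed.

Lemma state_ext U V : s_phi U = s_phi V -> s_u U = s_u V ->
  s_eta U = s_eta V -> s_z U = s_z V -> U = V.
Proof.
case: U => [[[p u] e] z]; case: V => [[[p' u'] e'] z'].
by rewrite /s_phi /s_u /s_eta /s_z /= => -> -> -> ->.
Qed.

Lemma jet_ext J K : j_phi J = j_phi K -> j_phiy J = j_phiy K ->
  j_phiyy J = j_phiyy K -> j_u J = j_u K -> j_uy J = j_uy K ->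
  j_eta J = j_eta K -> j_z J = j_z K -> J = K.
Proof.
case: J => [[[[[[p p'] p''] u] u'] e] z]; case: K => [[[[[[q q'] q''] v] v'] f] w].
rewrite /j_phi /j_phiy /j_phiyy /j_u /j_uy /j_eta /j_z /=.
by move=> -> -> -> -> -> -> ->.
Qed.

Lemma jrevB J K : jrev (J - K) = jrev J - jrev K.
Proof.
have e1 (a b : C) : - conjc (a - b) = - conjc a - - conjc b by rewrite rmorphB opprD.
have E1 (f g : R -> C^o) :
    (fun y => - conjc (f y - g y)) = (fun y => - conjc (f y)) - (fun y => - conjc (g y)) :> (R -> C^o).
  by apply/funext => y; exact: e1.
have E2 (f g : R -> C^o) :
    (fun y => conjc (f y - g y)) = (fun y => conjc (f y)) - (fun y => conjc (g y)) :> (R -> C^o).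
  by apply/funext => y; exact: rmorphB.
apply: jet_ext.
- exact: (E1 (j_phi J) (j_phi K)).
- exact: (E1 (j_phiy J) (j_phiy K)).
- exact: (E1 (j_phiyy J) (j_phiyy K)).
- exact: (E2 (j_u J) (j_u K)).
- exact: (E2 (j_uy J) (j_uy K)).
- exact: (rmorphB _ (j_eta J) (j_eta K)).
- exact: (e1 (j_z J) (j_z K)).
Qed.

Lemma jrevK : involutive jrev.
Proof.
have e1 (a : C) : - conjc (- conjc a) = a.
  by apply/eqP; rewrite eq_complex !(cReN, cImN, cReJ, cImJ) !opprK !eqxx.
move=> J; apply: jet_ext; try apply/funext => y;
  [exact: e1|exact: e1|exact: e1|exact: conjcK|exact: conjcK|exact: conjcK|exact: e1].
Qed.

Lemma Yeq_srev U V : Yeq U V -> Yeq (srev U) (srev V).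
Proof.
move=> [a1 a2 a3 a4]; split.
- by move=> y hy; rewrite /srev /s_phi /= -!/(s_phi _) a1.
- by apply: filterS a2 => y ha hy; rewrite /srev /s_u /= -!/(s_u _) ha.
- by rewrite /srev /s_eta /= -!/(s_eta _) a3.
- by rewrite /srev /s_z /= -!/(s_z _) a4.
Qed.

Section Domain.
Variable beta : R.

Lemma domL_lin (c : C) J K : domL beta J -> domL beta K -> domL beta (c *: J + K).
Proof.
case: J => [[[[[[p p'] p''] u] u'] e] z]; case: K => [[[[[[q q'] q''] v] v'] f] w].
move=> [a1 a2 a3 a4 a5] [b1 b2 b3 b4 b5]; split.
- exact: (weak_derivative_lin c a1 b1).
- exact: (weak_derivative_lin c a2 b2).
- exact: (weak_derivative_lin c a3 b3).
- move: a4 b4; rewrite /j_phiy /j_z /= !fctE => a4 b4.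
  have -> : c *: p' 1 + q' 1 + (c *: z + w) / beta%:C
     = c * (p' 1 + z / beta%:C) + (q' 1 + w / beta%:C).
    by rewrite /GRing.scale /=; ring.
  by rewrite a4 b4 mulr0 addr0.
- move: a5 b5; rewrite /j_phiy /= !fctE => -> ->.
  by rewrite scaler0 addr0.
Qed.

(** The sum starts from 0, whose membership is read off from [- K + K]. *)
Lemma domL_combination m (b : 'I_m -> jet R) (a : 'cV[C]_m) K :
  domL beta K -> (forall i, domL beta (b i)) -> domL beta (combination b a).
Proof.
move=> hK hb; rewrite /combination.
have h0 : domL beta 0 by rewrite -(addNr K) -scaleN1r; exact: domL_lin.
by elim/big_rec: _ => [|i J _ hJ]; [exact: h0|exact: domL_lin].
Qed.

Lemma domL_jrev J : domL beta J -> domL beta (jrev J).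
Proof.
case: J => [[[[[[p p'] p''] u] u'] e] z] [a1 a2 a3 a4 a5]; split.
- exact: weak_derivativeN (weak_derivativeJ a1).
- exact: weak_derivativeN (weak_derivativeJ a2).
- exact: weak_derivativeJ a3.
- move: a4; rewrite /jrev /j_phiy /j_z /= mulNr -opprD => a4.
  have -> : (conjc (p' 1)) + (conjc z) / beta%:C = (conjc (p' 1 + z / beta%:C)).
    by rewrite rmorphD rmorphM fmorphV /= oppr0.
  by rewrite a4 rmorph0 oppr0.
- by move: a5; rewrite /jrev /j_phiy /= => ->; rewrite rmorph0 oppr0.
Qed.

Lemma domL_inY J : domL beta J -> inY (toY J).
Proof.
move=> [a1 _ a3 _ _]; split; first by exists (j_phiy J).
exact: weak_derivative_L2 a3.
Qed.

End Domain.

(** Pointwise in u as well, unlike [Yeq]: the reversibility identities hold at every y in [0, 1],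
    and the integrands of [normY2] then coincide there. *)
Definition eq_on01 U V : Prop :=
  [/\ forall y, 0 <= y <= 1 -> s_phi U y = s_phi V y,
      forall y, 0 <= y <= 1 -> s_u U y = s_u V y,
      s_eta U = s_eta V & s_z U = s_z V].

(** [normY2] is an infimum over weak derivatives. The modulus-preserving [tau] sends each competitor
    for U to one for V of the same value, which gives one inequality; the converse needs a second
    application with the roles exchanged. *)
Lemma normY2_transfer U V (tau : (R -> C) -> (R -> C)) :
  (forall g, weak_derivative (s_phi U) g -> weak_derivative (s_phi V) (tau g)) ->
  (forall g y, cabs (tau g y) = cabs (g y)) ->
  (forall y, 0 <= y <= 1 -> cabs (s_phi U y) = cabs (s_phi V y)) ->
  (forall y, 0 <= y <= 1 -> cabs (s_u U y) = cabs (s_u V y)) ->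
  cabs (s_eta U) = cabs (s_eta V) -> cabs (s_z U) = cabs (s_z V) ->
  (normY2 V <= normY2 U)%E.
Proof.
move=> hw ht h1 h2 h3 h4; apply: le_ereal_inf => _ [g /hw wg ->].
exists (tau g) => //; rewrite h3 h4; congr (_ + _)%E.
apply: eq_integral => y; rewrite inE /I01 /= in_itv /= => y01.
by rewrite h1// h2// ht.
Qed.

Lemma eq_normY2 U V : eq_on01 U V -> normY2 U = normY2 V.
Proof.
move=> [h1 h2 h3 h4]; apply/eqP; rewrite eq_le; apply/andP; split.
- apply: (@normY2_transfer V U id) => //; try by move=> y /h1 ->.
  + by move=> g; apply: eq_weak_derivative => y /h1.
  + by move=> y /h2 ->.
  + by rewrite h3.
  + by rewrite h4.
- apply: (@normY2_transfer U V id) => //; try by move=> y /h1 ->.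
  + by move=> g; apply: eq_weak_derivative.
  + by move=> y /h2 ->.
  + by rewrite h3.
  + by rewrite h4.
Qed.

(** Right-hand sides transform by [- srev] rather than [srev], since differentiating [u (- x)] adds
    a sign. As an involution it is an isometry as soon as it does not increase the norm. *)
Lemma srevN_K U : - srev (- srev U) = U.
Proof.
have e1 (a : C) : - conjc (- conjc a) = a.
  by apply/eqP; rewrite eq_complex !(cReN, cImN, cReJ, cImJ) !opprK !eqxx.
have e2 (a : C) : - - conjc (- - conjc a) = a.
  by apply/eqP; rewrite eq_complex !(cReN, cImN, cReJ, cImJ) !opprK !eqxx.
apply: state_ext.
- by apply/funext => y; exact: (e2 (s_phi U y)).
- by apply/funext => y; exact: (e1 (s_u U y)).
- exact: (e1 (s_eta U)).
- exact: (e2 (s_z U)).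
Qed.

Lemma normY2_Nsrev U : normY2 (- srev U) = normY2 U.
Proof.
have le V : (normY2 (- srev V)%R <= normY2 V)%E.
  apply: (@normY2_transfer V (- srev V) (fun g y => conjc (g y))) => //.
  - move=> g /weak_derivativeJ; apply: eq_weak_derivative => y _.
    by rewrite /srev /s_phi /= fctE opprK.
  - by move=> g y; rewrite cabsJ.
  - by move=> y _; rewrite /srev /s_phi /= fctE opprK cabsJ.
  - by move=> y _; rewrite /srev /s_u /= fctE cabsN cabsJ.
  - by rewrite /srev /s_eta /= cabsN cabsJ.
  - by rewrite /srev /s_z /= opprK cabsJ.
by apply/eqP; rewrite eq_le le/= -[leLHS]/(normY2 U) -{1}(srevN_K U) le.
Qed.

Lemma normD2_jrev J : normD2 (jrev J) = normD2 J.
Proof.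
rewrite /normD2 /jrev /j_phi /j_phiy /j_phiyy /j_u /j_uy /j_eta /j_z /=.
congr (_ + _)%E; last by rewrite cabsN !cabsJ.
by apply: eq_integral => y _; rewrite !cabsN !cabsJ.
Qed.

Lemma eq_on01_subl V U W : eq_on01 U W -> eq_on01 (V - U) (V - W).
Proof.
case: U => [[[p u] e] z]; case: V => [[[p' u'] e'] z']; case: W => [[[p2 u2] e2] z2].
rewrite /eq_on01 /s_phi /s_u /s_eta /s_z /= => -[h1 h2 -> ->].
by split => // y y01; rewrite !fctE ?h1 ?h2.
Qed.

Lemma bounded_solution_rev (beta : R) (F G : R -> jet R -> state R) (u : R -> jet R) :
  (forall x J, domL beta J -> eq_on01 (G x (jrev J)) (- srev (F (- x) J))) ->
  bounded_solution beta F u -> bounded_solution beta G (fun x => jrev (u (- x))).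
Proof.
move=> FG [hd hc hD [M hM]].
have N0 : (fun h : R => - h) @ (0 : R) --> (0 : R).
  by rewrite -[X in _ --> X]oppr0; exact: opp_continuous.
split.
- by move=> x; exact: domL_jrev.
- move=> x.
  under eq_fun do rewrite -jrevB normD2_jrev opprD.
  exact: (cvg_comp _ _ N0 (hc (- x))).
- move=> x.
  have N0' : (fun h : R => - h) @ (0 : R)^' --> (0 : R)^'.
    move=> A [e /= e0 he]; exists e => //= h hh h0.
    by apply: he; rewrite /= ?oppr_eq0//; move: hh; rewrite /= !sub0r !normrN.
  have := cvg_comp _ _ N0' (hD (- x)).
  apply: cvg_trans; apply: near_eq_cvg; near=> h.
  (* The difference quotient of the reflected function at h is [- srev] of that of u at [- h], and
     [- srev] preserves the norm. *)
  rewrite /= -[LHS]normY2_Nsrev; apply: eq_normY2.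
  have conj_inv : (conjc (((- h)%:C)^-1)) = - (h%:C)^-1 :> C.
    by rewrite conjc_inv conjc_real rmorphN invrN.
  rewrite srevB srevZ conj_inv scaleNr -opprD opprK srevB -!toY_jrev opprD.
  rewrite -[srev (F _ _)]opprK; apply: eq_on01_subl.
  by have [h1 h2 h3 h4] := FG x _ (hd (- x)); split => // y hy; rewrite ?h1 ?h2.
- by exists M => x; rewrite normD2_jrev.
Unshelve. all: by end_near.
Qed.
End States.

(** * Parity of the wave and reversibility of the linearized equations *)

Section Parity.
Context {R : realType}.
Implicit Types (f g : R -> R).

Lemma cJ_real (a : R) : conjc a%:C = a%:C.
Proof. by rewrite /conjc /= oppr0. Qed.

Lemma cJD (a b : R[i]) : conjc (a + b) = conjc a + conjc b.
Proof. exact: rmorphD. Qed.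

Lemma cJN (a : R[i]) : conjc (- a) = - conjc a.
Proof. exact: rmorphN. Qed.

Lemma cJM (a b : R[i]) : conjc (a * b) = conjc a * conjc b.
Proof. exact: rmorphM. Qed.

Lemma cJV (a : R[i]) : conjc a^-1 = (conjc a)^-1.
Proof. exact: fmorphV. Qed.

Definition cJE := (cJD, cJN, cJM, cJV, cJ_real, conjcK).

Lemma derive1_default f x : ~ derivable f x 1 -> derive1 f x = 0.
Proof. by move=> nd; rewrite derive1E /derive dvgP. Qed.

(* No differentiability is assumed: both sides are 0 where it fails. *)
Lemma derive1_affine f g (a : R) x : a ^+ 2 = 1 -> (forall t, g t = f (a * t)) ->
  derive1 g x = a * derive1 f (a * x).
Proof.
move=> a2 gf.
have d u v y : (forall t, v t = u (a * t)) -> derivable u (a * y) 1 ->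
    is_derive y 1 v (a * derive1 u (a * y)).
  move=> vu /derivableP du.
  have da : is_derive y 1 (fun t => a * t) a.
    by refine (is_derive_congr (is_deriveZ a (is_derive_id y 1)) _ _) => //; exact: mulr1.
  refine (is_derive_congr (@is_derive1_comp _ u (fun t => a * t) y _ _ du da) _ _) => //.
  by rewrite derive1E mulrC.
have [df|ndf] := pselect (derivable f (a * x) 1).
  by rewrite derive1E (@derive_val _ _ _ _ _ _ _ (d _ _ _ gf df)).
rewrite (derive1_default ndf) mulr0; apply: derive1_default => dg; apply: ndf.
(* As a^2 = 1, the same substitution recovers f from g, so f would be differentiable if g were. *)
have fg t : f t = g (a * t) by rewrite gf mulrA -expr2 a2 mul1r.
apply: (@ex_derive _ _ _ _ _ _ _ (d g f (a * x) fg _)).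
by rewrite mulrA -expr2 a2 mul1r.
Qed.

Lemma derive1_opp f x : derive1 (fun t => - f t) x = - derive1 f x.
Proof.
have [df|ndf] := pselect (derivable f x 1).
  by rewrite !derive1E deriveN.
rewrite (derive1_default ndf) oppr0; apply: derive1_default => /derivableN dg; apply: ndf.
by move: dg; rewrite (_ : - _ = f)//; apply/funext => t; exact: opprK.
Qed.

Lemma derive1_even f : (forall t, f (- t) = f t) ->
  forall x, derive1 f (- x) = - derive1 f x.
Proof.
move=> ef x.
have := @derive1_affine f f (-1) x _ _; rewrite !mulN1r => -> //; rewrite ?opprK//.
  by rewrite sqrrN expr1n.
by move=> t; rewrite mulN1r ef.
Qed.

Lemma derive1_odd f : (forall t, f (- t) = - f t) ->
  forall x, derive1 f (- x) = derive1 f x.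
Proof.
move=> ef x.
have := @derive1_affine f (fun t => - f t) (-1) x _ _; rewrite derive1_opp !mulN1r.
move=> h; apply: oppr_inj; rewrite -h// ?sqrrN ?expr1n//.
by move=> t; rewrite mulN1r ef.
Qed.

(* The endpoints are included, so the ordinary derivative is determined by
   the one-sided data. *)
Lemma derive1_eq_on01 f g y : 0 <= y <= 1 -> derivable f y 1 -> derivable g y 1 ->
  (forall t, 0 <= t <= 1 -> f t = g t) -> derive1 f y = derive1 g y.
Proof.
move=> y01 df dg fg; apply/eqP; rewrite -subr_eq0; apply/eqP.
rewrite !derive1E -(deriveB df dg).
have dh := derivableB df dg; set h := f - g in dh *.
have hz t : 0 <= t <= 1 -> h t = 0 by move=> /fg; rewrite /h fctE => ->; exact: subrr.
apply/eqP/negPn/negP => L0.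
have L1 : 0 < `|'D_1 h y| by rewrite normr_gt0.
have [/= e e0 he] := (@cvgrPdist_lt _ _ _ _ _ _ _).1 dh _ L1.
have [m [m0 me m1]] : exists m, [/\ 0 < m, m < e & m <= 1 / 2].
  exists (Num.min (e / 2) (1 / 2)); split.
  - by rewrite lt_min divr_gt0//=; lra.
  - by rewrite gt_min; apply/orP; left; lra.
  - by rewrite ge_min lexx orbT.
(* The increment points into [0, 1], where h vanishes: the quotient is 0, yet its distance to the
   derivative L is strictly less than |L|. *)
pose k := if y <= 1 / 2 then m else - m.
have k0 : k != 0 by rewrite /k; case: ifP => _; rewrite ?oppr_eq0 gt_eqF.
have kn : `|k| < e by rewrite /k; case: ifP => _; rewrite ?normrN gtr0_norm.
have ky : 0 <= k + y <= 1.
  by rewrite /k; case: ifP => hy; move: y01 => /andP[? ?]; apply/andP; split; lra.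
have /(_ _ k0) := he k; rewrite /= sub0r normrN => /(_ kn).
rewrite -/('D_1 h y); move: ('D_1 h y) => L.
rewrite /= [k *: 1]mulr1 (hz (k + y))// hz// subrr scaler0 subr0.
by rewrite ltxx.
Qed.

End Parity.

(** * Coefficients and right-hand sides of the linearized equations under reversal *)

Section WaveParity.
Context {R : realType}.
Variables (phib : R -> R -> R) (etab : R -> R).
Hypothesis phib_C2 : C2_plane phib.
Hypothesis phib_odd : forall x y, 0 <= y <= 1 -> phib (- x) y = - phib x y.
Hypothesis etab_even : forall x, etab (- x) = etab x.

Let one01 : 0 <= (1 : R) <= 1. Proof. by rewrite ler01 lexx. Qed.

Lemma etax_odd x : derive1 etab (- x) = - derive1 etab x.
Proof. exact: derive1_even. Qed.

Lemma Dx_phib_even x y : 0 <= y <= 1 -> Dx phib (- x) y = Dx phib x y.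
Proof. by move=> y01; rewrite /Dx; apply: derive1_odd => t; exact: phib_odd. Qed.

(** Oddness is known only on the closed strip, so y-derivatives on its boundary are compared through
    one-sided data, which requires differentiability; x-derivatives keep y fixed and avoid this. *)
Lemma Dy_odd (f : R -> R -> R) : partially_derivable f ->
  (forall x y, 0 <= y <= 1 -> f (- x) y = - f x y) ->
  forall x y, 0 <= y <= 1 -> Dy f (- x) y = - Dy f x y.
Proof.
move=> df fo x y y01; rewrite /Dy -derive1_opp; apply: derive1_eq_on01 => //.
- exact: (df _ _).2.
- by apply: derivableN; exact: (df _ _).2.
- by move=> t; exact: fo.
Qed.

Lemma Dy_phib_odd x y : 0 <= y <= 1 -> Dy phib (- x) y = - Dy phib x y.
Proof. by apply: Dy_odd => //; case: phib_C2. Qed.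

Lemma Dyy_phib_odd x y : 0 <= y <= 1 -> Dy (Dy phib) (- x) y = - Dy (Dy phib) x y.
Proof. by apply: Dy_odd; [case: phib_C2|exact: Dy_phib_odd]. Qed.

Lemma ubar_even x y : 0 <= y <= 1 -> ubar phib etab (- x) y = ubar phib etab x y.
Proof.
move=> y01; rewrite /ubar Dx_phib_even// Dy_phib_odd// etax_odd etab_even.
by rewrite !(mulrN, mulNr) opprK.
Qed.

Lemma derivable_ubar x y : derivable (ubar phib etab x) y 1.
Proof.
have [_ dX dY _] := phib_C2.
have d := derivableB (dX x y).2 (derivableZ (k := derive1 etab x / (1 + etab x))
  (derivableM (@derivable_id _ _ y 1) (dY x y).2)).
suff -> : ubar phib etab x = Dx phib x - (derive1 etab x / (1 + etab x)) \*: (id * Dy phib x).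
  exact: d.
apply/funext => t.
transitivity (Dx phib x t - derive1 etab x / (1 + etab x) * (t * Dy phib x t)) => //.
by rewrite /ubar; ring.
Qed.

Lemma Dy_ubar_even x y : 0 <= y <= 1 ->
  Dy (ubar phib etab) (- x) y = Dy (ubar phib etab) x y.
Proof.
move=> y01; apply: (derive1_eq_on01 y01); [exact: derivable_ubar|exact: derivable_ubar|].
by move=> t; exact: ubar_even.
Qed.

Lemma slope_even x : slope etab (- x) = slope etab x.
Proof. by rewrite /slope etax_odd sqrrN. Qed.

Lemma cV_even x : cV phib etab (- x) = cV phib etab x.
Proof. by rewrite /cV (ubar_even _ one01) etab_even slope_even. Qed.

Lemma cU_odd x : cU etab (- x) = - cU etab x.
Proof. by rewrite /cU etax_odd etab_even mulNr. Qed.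

Lemma cE0_odd x : cE0 phib etab (- x) = - cE0 phib etab x.
Proof. by rewrite /cE0 (Dy_phib_odd _ one01) etab_even mulNr. Qed.

Local Notation C := R[i].

Lemma moment_conj (f g : R -> C) y : 0 <= y <= 1 ->
  (forall t, 0 <= t <= 1 -> g t = conjc (f t)) -> moment g y = conjc (moment f y).
Proof.
move=> /andP[_ y1] fg; rewrite /moment -cintegralJ; apply: eq_cintegral => t.
rewrite inE /= in_itv /= => /andP[t0 ty].
by rewrite fg ?t0 ?(le_trans ty)// cJM cJ_real.
Qed.

Lemma moment_Nconj (f g : R -> C) y : 0 <= y <= 1 ->
  (forall t, 0 <= t <= 1 -> g t = - conjc (f t)) -> moment g y = - conjc (moment f y).
Proof.
move=> y01 fg; rewrite (@moment_conj (fun t => - f t) g)//; last first.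
  by move=> t t01; rewrite fg// cJN.
rewrite -cJN; congr conjc; rewrite /moment -cintegralN; apply: eq_cintegral => t _.
by rewrite mulrN.
Qed.

Variables (beta mu : R) (lambda : C) (x : R) (U : jet R).
Local Notation lambda' := (- conjc lambda).

(** Conjugation acts on lambda, while the oddness of [cE0] asks for an overall sign; the two terms
    agree because the parameter becomes [- conjc lambda]. *)
Lemma cE_rev : cE phib etab lambda' x = - conjc (cE phib etab lambda (- x)).
Proof.
rewrite /cE etab_even cE0_odd !cJE.
ring.
Qed.

Lemma cEx_rev : cEx phib etab lambda' x = conjc (cEx phib etab lambda (- x)).
Proof.
rewrite /cEx etax_odd (derive1_odd cE0_odd) !cJE.
ring.
Qed.

Lemma phi_of_rev y : 0 <= y <= 1 ->
  phi_of phib etab lambda' x (jrev U) y = - conjc (phi_of phib etab lambda (- x) U y).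
Proof.
move=> y01; rewrite /phi_of cE_rev cV_even cU_odd.
rewrite (@moment_conj (j_u U) (j_u (jrev U)))//.
rewrite -[j_phi (jrev U) y]/(- conjc (j_phi U y)) -[j_eta (jrev U)]/(conjc (j_eta U)).
rewrite !cJE.
ring.
Qed.

Lemma phiy_of_rev y :
  phiy_of phib etab lambda' x (jrev U) y = - conjc (phiy_of phib etab lambda (- x) U y).
Proof.
rewrite /phiy_of cE_rev cV_even cU_odd.
rewrite -[j_phiy (jrev U) y]/(- conjc (j_phiy U y)) -[j_eta (jrev U)]/(conjc (j_eta U)).
rewrite -[j_u (jrev U) y]/(conjc (j_u U y)) !cJE.
ring.
Qed.

Lemma phiyy_of_rev y :
  phiyy_of phib etab lambda' x (jrev U) y = - conjc (phiyy_of phib etab lambda (- x) U y).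
Proof.
rewrite /phiyy_of cE_rev cV_even cU_odd.
rewrite -[j_phiyy (jrev U) y]/(- conjc (j_phiyy U y)) -[j_eta (jrev U)]/(conjc (j_eta U)).
rewrite -[j_u (jrev U) y]/(conjc (j_u U y)) -[j_uy (jrev U) y]/(conjc (j_uy U y)) !cJE.
ring.
Qed.

Lemma phix_rhs_rev y : 0 <= y <= 1 ->
  phix_rhs beta phib etab lambda' x (jrev U) y
  = conjc (phix_rhs beta phib etab lambda (- x) U y).
Proof.
move=> y01; rewrite /phix_rhs phiy_of_rev etax_odd etab_even slope_even (Dy_phib_odd _ y01).
rewrite -[j_u (jrev U) y]/(conjc (j_u U y)) -[j_eta (jrev U)]/(conjc (j_eta U)).
rewrite -[j_z (jrev U)]/(- conjc (j_z U)) !cJE !(mulrN, mulNr, opprK).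
ring.
Qed.

Lemma ux_rhs_rev y : 0 <= y <= 1 ->
  ux_rhs beta phib etab lambda' x (jrev U) y
  = - conjc (ux_rhs beta phib etab lambda (- x) U y).
Proof.
move=> y01; rewrite /ux_rhs phiyy_of_rev etax_odd etab_even slope_even.
rewrite (Dy_ubar_even _ y01) (Dyy_phib_odd _ y01).
rewrite -[j_uy (jrev U) y]/(conjc (j_uy U y)) -[j_eta (jrev U)]/(conjc (j_eta U)).
rewrite -[j_z (jrev U)]/(- conjc (j_z U)) !cJE !(mulrN, mulNr, opprK).
ring.
Qed.

Lemma etax_rhs_rev :
  etax_rhs beta etab x (jrev U) = - conjc (etax_rhs beta etab (- x) U).
Proof.
rewrite /etax_rhs slope_even -[j_z (jrev U)]/(- conjc (j_z U)) !cJE.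
by rewrite mulrN.
Qed.

Lemma zx_rhs_rev :
  zx_rhs beta phib etab mu lambda' x (jrev U)
  = conjc (zx_rhs beta phib etab mu lambda (- x) U).
Proof.
rewrite /zx_rhs (phi_of_rev one01) (ubar_even _ one01) (Dy_phib_odd _ one01) etax_odd.
rewrite etab_even slope_even.
rewrite -[j_u (jrev U) 1]/(conjc (j_u U 1)) -[j_eta (jrev U)]/(conjc (j_eta U)).
rewrite -[j_z (jrev U)]/(- conjc (j_z U)) !cJE !(mulrN, mulNr, opprK).
ring.
Qed.

Lemma varphix_rhs_rev y : 0 <= y <= 1 ->
  varphix_rhs beta phib etab lambda' x (jrev U) y
  = conjc (varphix_rhs beta phib etab lambda (- x) U y).
Proof.
move=> y01; rewrite /varphix_rhs (phix_rhs_rev y01) cEx_rev cE_rev etax_rhs_rev.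
rewrite cV_even cU_odd (derive1_even cV_even) (derive1_odd cU_odd).
rewrite (@moment_conj (j_u U) (j_u (jrev U)))//.
rewrite (moment_Nconj y01 ux_rhs_rev).
rewrite -[j_phi (jrev U) y]/(- conjc (j_phi U y)) -[j_eta (jrev U)]/(conjc (j_eta U)).
rewrite !cJE !(mulrN, mulNr, opprK).
ring.
Qed.

(** Differentiation in x exchanges even and odd, so each component of the right-hand side carries
    the sign opposite to its sign in [jrev]; hence the minus in front of [srev]. *)
Lemma linearized_rhs_rev :
  eq_on01 (linearized_rhs beta phib etab mu lambda' x (jrev U))
          (- srev (linearized_rhs beta phib etab mu lambda (- x) U)).
Proof.
split=> [y y01|y y01||].
- rewrite -[LHS]/(varphix_rhs beta phib etab lambda' x (jrev U) y) varphix_rhs_rev//.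
  exact: (esym (opprK _)).
- exact: ux_rhs_rev.
- exact: etax_rhs_rev.
- rewrite -[LHS]/(zx_rhs beta phib etab mu lambda' x (jrev U)) zx_rhs_rev.
  exact: (esym (opprK _)).
Qed.

End WaveParity.

(** * Floquet solutions and the reduced system *)

Section Floquet.
Context {R : realType} {m : nat}.
Local Notation C := R[i].

Lemma cabs_cis (t : R) : cabs (cis t) = 1.
Proof. by rewrite /= cos2Dsin2 sqrtr1. Qed.

Lemma conj_cis (t : R) : cis t * conjc (cis t) = 1.
Proof.
apply/eqP; rewrite eq_complex cReM cImM /= mulrN opprK -!expr2 cos2Dsin2 eqxx /=.
by rewrite mulrN mulrC addNr.
Qed.

Lemma periodic_bounded (N : R -> R) (T : R) : 0 < T -> continuous N ->
  (forall x, N (x + T) = N x) -> exists M, forall x, N x <= M.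
Proof.
move=> T0 cN pN.
have [c _ hc] := EVT_max (ltW T0) (continuous_subspaceT cN).
exists (N c) => x.
have pn (n : nat) y : N (y + n%:R * T) = N y.
  elim: n => [|n IH]; first by rewrite mul0r addr0.
  by rewrite -natr1 mulrDl mul1r addrA pN.
have pz (n : int) y : N (y + n%:~R * T) = N y.
  case: n => n; first exact: pn.
  by rewrite NegzE mulrNz mulNr -[RHS](pn n.+1) -[in RHS](subrK (n.+1%:R * T) y)
    -(pn n.+1 (y - _)) subrK.
set n := Num.floor (x / T).
rewrite -(subrK (n%:~R * T) x) pz; apply: hc.
have /andP[h1 h2] := floor_itv (x / T).
rewrite in_itv /= subr_ge0 -ler_pdivlMr// h1 /= lerBlDr -{1}[T]mul1r -mulrDl.
by rewrite -ler_pdivrMr// addrC ltW// -intrD1.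
Qed.

Lemma sqnormZ (c : C) (v : 'cV[C]_m) : sqnorm (c *: v) = cabs c ^+ 2 * sqnorm v.
Proof.
rewrite /sqnorm mulr_sumr; apply: eq_bigr => i _.
by rewrite mxE -!sqr_cabs ComplexField.Normc.normcM exprMn.
Qed.

(** A Floquet solution need not be periodic, but its norm is, as |rho| = 1. The bound M + 1 comes
    from t <= t^2 + 1. *)
Lemma floquet_bounded (A : R -> 'M[C]_m) (a : R -> 'cV[C]_m) (T : R) (rho : C) :
  0 < T -> cabs rho = 1 -> linear_ode A a ->
  (forall x, a (x + T) = rho *: a x) ->
  exists M : R, forall x i, cabs (a x i 0) <= M.
Proof.
move=> T0 rho1 sa qa.
have cN : continuous (fun t => sqnorm (a t)).
  move=> t; apply: differentiable_continuous; apply/derivable1_diffP.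
  exact: (@ex_derive _ _ _ _ _ _ _ (@is_derive_sqnorm _ _ a (fun x => A x *m a x) t (sa t))).
have [x|M hM] := periodic_bounded T0 cN; first by rewrite qa sqnormZ rho1 expr1n mul1r.
exists (M + 1) => x i.
have := sqnorm_term (a x) i; rewrite -sqr_cabs => h.
have := hM x; have := cabs_ge0 (a x i 0); nra.
Qed.

(** [det0P] is about row vectors, whence the transposes. *)
Lemma evans_zeroP (M : 'M[C]_m) (rho : C) :
  \det (rho%:M - M) = 0 <-> exists2 v : 'cV[C]_m, v != 0 & M *m v = rho *: v.
Proof.
split=> [h|[v v0 hv]].
  have /det0P[v v0 hv] : \det (rho%:M - M)^T == 0 by rewrite det_tr h.
  exists v^T; first by rewrite -(inj_eq (@trmx_inj _ _ _)) trmxK trmx0.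
  apply/eqP; rewrite -mul_scalar_mx eq_sym -subr_eq0 -mulmxBl.
  by rewrite -[_ - M]trmxK -trmx_mul hv trmx0.
apply/eqP; rewrite -det_tr; apply/det0P; exists v^T.
  by rewrite -(inj_eq (@trmx_inj _ _ _)) trmxK trmx0.
by rewrite -trmx_mul mulmxBl hv mul_scalar_mx subrr trmx0.
Qed.

(** Uniqueness for the periodic system carries the multiplier relation from x = 0 to all x. *)
Lemma floquet_solution (A X : R -> 'M[C]_m) (T : R) (rho : C) (v : 'cV[C]_m) :
  (forall i j, ccontinuous (fun x => A x i j)) -> (forall x, A (x + T) = A x) ->
  fundamental_matrix A X -> X T *m v = rho *: v ->
  forall x, X (x + T) *m v = rho *: (X x *m v).
Proof.
move=> cA pA fX hv; have sX := linear_ode_fundamental v fX.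
apply: (linear_ode_unique cA (linear_ode_shift pA sX) (linear_ode_scale rho sX)).
by rewrite add0r hv fX.1 mul1mx.
Qed.

End Floquet.

(** * Coordinates on the centre space [Ysigma] *)

Section Reduction.
Context {R : realType}.
Local Notation C := R[i].
Variables (beta kappa sigma : R) (m : nat) (b : 'I_m -> jet R).
Hypothesis basis_b : Ysigma_basis beta kappa sigma b.

Lemma toY_lin (c : C) (J K : jet R) : toY (c *: J + K) = c *: toY J + toY K.
Proof.
case: J => [[[[[[p p'] p''] u] u'] e] z]; case: K => [[[[[[q q'] q''] v] v'] f] w].
by rewrite /toY /j_phi /j_u /j_eta /j_z /=.
Qed.

Lemma combination_lin (c : C) (a a' : 'cV[C]_m) :
  combination b (c *: a + a') = c *: combination b a + combination b a'.
Proof.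
rewrite /combination scaler_sumr -big_split /=; apply: eq_bigr => i _.
by rewrite !mxE scalerDl scalerA.
Qed.

Lemma combination0 : combination b 0 = 0.
Proof. by rewrite /combination big1// => i _; rewrite mxE scale0r. Qed.

Lemma domLZ (c : C) (J : jet R) : domL beta J -> domL beta (c *: J).
Proof.
move=> dJ; rewrite -[c *: J]addr0; apply: domL_lin => //.
by rewrite -(addNr J) -scaleN1r; exact: domL_lin.
Qed.

Lemma gen_eigenvector_domL nu n (J : jet R) :
  gen_eigenvector beta kappa sigma nu n J -> domL beta J.
Proof. by case: n => [|n] []. Qed.

Lemma opLZ mu0 (lambda c : C) (J : jet R) :
  opL beta mu0 lambda (c *: J) = c *: opL beta mu0 lambda J.
Proof.
apply: state_ext.
- apply/funext => y.
  rewrite -[RHS]/(c * (j_u J y - lambda * (y ^+ 2 / (2 * beta))%:C * j_z J)).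
  rewrite -[LHS]/(c * j_u J y - lambda * (y ^+ 2 / (2 * beta))%:C * (c * j_z J)).
  by ring.
- apply/funext => y.
  rewrite -[RHS]/(c * (- j_phiyy J y - lambda * j_eta J)).
  rewrite -[LHS]/(- (c * j_phiyy J y) - lambda * (c * j_eta J)).
  by ring.
- exact: (esym (mulrA c (j_z J) _)).
- rewrite -[RHS]/(c * (lambda ^+ 2 * j_eta J / (2 * mu0)%:C
    + lambda * j_phi J 1 / mu0%:C + j_eta J - j_u J 1 / mu0%:C)).
  rewrite -[LHS]/(lambda ^+ 2 * (c * j_eta J) / (2 * mu0)%:C
    + lambda * (c * j_phi J 1) / mu0%:C + c * j_eta J - c * j_u J 1 / mu0%:C).
  by ring.
Qed.

Lemma toYZ (c : C) (J : jet R) : toY (c *: J) = c *: toY J.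
Proof. by []. Qed.

(** Vectors of [Ysigma] are plain sums of generalized eigenvectors, so the coefficients of a
    combination have to be absorbed into the summands. *)
Lemma gen_eigenvectorZ (c : C) nu n (J : jet R) :
  gen_eigenvector beta kappa sigma nu n J ->
  gen_eigenvector beta kappa sigma nu n (c *: J).
Proof.
elim: n J => [|n IH] J /= [dJ h]; split; try exact: domLZ.
  by rewrite toYZ -(scaler0 _ c); exact: YeqZ.
case: h => V [hV gV]; exists (c *: V); split; last exact: IH.
rewrite opLZ !toYZ scalerA mulrC -scalerA -scalerBr; exact: YeqZ.
Qed.

Lemma domL_basis a : (0 < m)%N -> domL beta (combination b a).
Proof.
move=> m0; have db i : domL beta (b i).
  by have [+ _ _] := basis_b => /(_ i)[k [n /gen_eigenvector_domL]].
exact: (domL_combination a (db (Ordinal m0)) db).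
Qed.

Lemma Ysigma_combination a : Ysigma beta kappa sigma (toY (combination b a)).
Proof.
have [gb _ _] := basis_b.
have /choice[k hk] : forall i, exists k : R, exists n, gen_eigenvector beta kappa sigma (k *i) n (b i).
  by [].
have /choice[n hn] := hk.
exists m, k, n, (fun i => a i 0 *: b i); split.
  by move=> i; exact: gen_eigenvectorZ.
rewrite /combination (big_morph (@toY R) (id1 := 0) (op1 := +%R))//.
exact: Yeq_refl.
Qed.

Lemma combination_inj a a' :
  Yeq (toY (combination b a)) (toY (combination b a')) -> a = a'.
Proof.
move=> h; apply/eqP; rewrite -subr_eq0; apply/eqP.
have [_ ind _] := basis_b; apply: ind.
rewrite -[a - a']addrC -scaleN1r combination_lin toY_lin.
have := Yeq_lin (-1) (Yeq_sym h) (Yeq_refl (toY (combination b a))).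
by rewrite [(-1) *: toY (combination b a)]scaleN1r addNr.
Qed.

End Reduction.

(** * Symmetry of the periodic Evans function *)

Section EvansSymmetry.
Context {R : realType}.
Local Notation C := R[i].
Variables (beta kappa : R).
Variables (phib : R -> R -> R -> R) (etab : R -> R -> R) (mu : R -> R).
Variables (sigma e : R).
Variables (m : nat) (b : 'I_m -> jet R) (P : state R -> state R).
Variable w : C -> R -> R -> jet R -> jet R.
Hypothesis m_gt0 : (0 < m)%N.
Hypothesis kappa_gt0 : 0 < kappa.
Hypothesis phib_C2 : C2_plane (phib e).
Hypothesis phib_odd : forall x y, 0 <= y <= 1 -> phib e (- x) y = - phib e x y.
Hypothesis etab_even : forall x, etab e (- x) = etab e x.
Hypothesis basis_b : Ysigma_basis beta kappa sigma b.
Hypothesis proj_P : spectral_projection beta kappa sigma P.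

Local Notation T := (period kappa).
Local Notation comb := (combination b).
Local Notation rhs := (spectral_rhs beta kappa phib etab mu sigma).
Local Notation redmap := (reduction_map beta kappa phib etab mu sigma b P w).

(** The operator L cancels against its copy in [opB], so reversibility can be checked on the
    linearized equations themselves. *)
Lemma spectral_rhsE d x J :
  rhs d e x J = linearized_rhs beta (phib e) (etab e) (mu e) (sigma *i + d) x J.
Proof. by rewrite /spectral_rhs /opB addrC subrK. Qed.

Lemma spectral_rhs_rev d x J :
  eq_on01 (rhs (- conjc d) e x (jrev J)) (- srev (rhs d e (- x) J)).
Proof.
rewrite !spectral_rhsE.
(* The point i sigma lies on the imaginary axis, which the reflection fixes. *)
have -> : sigma *i + - conjc d = - conjc (sigma *i + d) :> C.
  apply/eqP; rewrite eq_complex !(cReN, cImN, cReJ, cImJ, cReD, cImD) /=.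
  by apply/andP; split; apply/eqP; ring.
exact: linearized_rhs_rev.
Qed.

Lemma toYD (J K : jet R) : toY (J + K) = toY J + toY K.
Proof. by have := toY_lin 1 J K; rewrite !scale1r. Qed.

Lemma domLD (J K : jet R) : domL beta J -> domL beta K -> domL beta (J + K).
Proof. by move=> dJ dK; rewrite -[J]scale1r; exact: domL_lin. Qed.

Lemma eq_Yeq (U V : state R) : U = V -> Yeq U V.
Proof. by move=> ->; exact: Yeq_refl. Qed.

Lemma inY0 : inY (0 : state R).
Proof.
have d0 := domLZ 0 (domL_basis basis_b 0 m_gt0).
by have := domL_inY d0; rewrite toYZ scale0r.
Qed.

Lemma proj0 : Yeq (P 0) 0.
Proof.
(* With c = -1 and both arguments 0, linearity reads P 0 = - P 0 + P 0. *)
have := proj_linear proj_P (-1) inY0 inY0.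
by rewrite scaler0 addr0 scaleN1r addNr.
Qed.

Lemma projZ (c : C) U : inY U -> Yeq (P (c *: U)) (c *: P U).
Proof.
move=> iU; have h := proj_linear proj_P c iU inY0; rewrite addr0 in h.
apply: (Yeq_trans h); rewrite -[X in Yeq _ X]addr0.
by apply: YeqD; [exact: Yeq_refl|exact: proj0].
Qed.

(** P inverts the reduction: it fixes the combination, which lies in [Ysigma], and annihilates the
    values of w. *)
Lemma reduced_solution_proj d x a J : redmap d e ->
  Yeq (toY J) (toY (comb a + w d e x (comb a))) -> Yeq (P (toY J)) (toY (comb a)).
Proof.
move=> rm hJ.
have dc := domL_basis basis_b a m_gt0.
have dw := red_dom rm x a.
have iY : inY (toY (comb a + w d e x (comb a))).
  exact: domL_inY (domLD dc dw).
apply: (Yeq_trans (Yeq_sym (proj_eq proj_P iY (Yeq_sym hJ)))).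
have h1 := proj_linear proj_P 1 (domL_inY dc) (domL_inY dw).
move: h1; rewrite !scale1r => h1.
rewrite toYD.
apply: (Yeq_trans h1).
rewrite -[X in Yeq _ X]addr0; apply: YeqD; last exact: (red_ker rm).
exact: (proj_id proj_P (Ysigma_combination basis_b a)).
Qed.

Lemma reduction_map0 d x : redmap d e -> Yeq (toY (w d e x (comb 0))) 0.
Proof.
move=> rm; have := red_linear rm x (-1) 0 0.
by rewrite scaler0 addr0 scaleN1r addNr.
Qed.

Lemma reduced_solution_shift d x a (rho : C) : redmap d e ->
  (forall x, a (x + T) = rho *: a x) ->
  Yeq (toY (comb (a (x + T)) + w d e (x + T) (comb (a (x + T)))))
      (rho *: toY (comb (a x) + w d e x (comb (a x)))).
Proof.
move=> rm qa.
apply: (Yeq_trans (eq_Yeq (toYD _ _))).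
apply: (Yeq_trans _ (YeqZ rho (eq_Yeq (esym (toYD _ _))))).
apply: (Yeq_trans _ (eq_Yeq (esym (scalerDr _ _ _)))).
apply: YeqD.
  rewrite qa -[rho *: a x]addr0 combination_lin combination0 addr0 toYZ.
  exact: Yeq_refl.
apply: (Yeq_trans (red_periodic rm x _)).
rewrite qa -[rho *: a x]addr0; apply: (Yeq_trans (red_linear rm x rho _ _)).
rewrite -[X in Yeq _ X]addr0; apply: YeqD; first exact: Yeq_refl.
exact: reduction_map0.
Qed.

Lemma evans_symmetric (A X : C -> R -> R -> 'M[C]_m) (d : C) (k : R) :
  redmap d e -> redmap (- conjc d) e ->
  coordinate_system beta kappa phib etab mu sigma b P w d e (A d e) ->
  coordinate_system beta kappa phib etab mu sigma b P w (- conjc d) e (A (- conjc d) e) ->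
  fundamental_matrix (A d e) (X d e) ->
  fundamental_matrix (A (- conjc d) e) (X (- conjc d) e) ->
  periodic_evans kappa X d k e = 0 -> periodic_evans kappa X (- conjc d) k e = 0.
Proof.
move=> rm rm' cs cs' fX fX' /evans_zeroP[v v0 hv]; apply/evans_zeroP.
set rho := cis (k * T) in hv *.
have T_gt0 : 0 < T by rewrite divr_gt0// mulr_gt0// pi_gt0.
have [cA pA ceq] := cs; have [cA' pA' ceq'] := cs'.
pose a t := X d e t *m v.
have sa : linear_ode (A d e) a := linear_ode_fundamental v fX.
have qa : forall x, a (x + T) = rho *: a x.
  exact: (floquet_solution cA pA fX hv).
have ba : bounded_reduced_solution beta kappa phib etab mu sigma b P w d e a.
  split; last exact: (floquet_bounded T_gt0 (cabs_cis _) sa qa).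
  exists (fun x => A d e x *m a x) => x; split; first exact: sa.
  exact: ceq.
pose u x := comb (a x) + w d e x (comb (a x)).
have du x : domL beta (u x).
  by apply: domLD; [exact: (domL_basis basis_b _ m_gt0)|exact: red_dom rm x (a x)].
have bu : bounded_solution beta (rhs d e) u.
  apply/(red_equiv rm du); exists a; first exact: ba.
  by move=> x v'; exact: Yeq_refl.
pose us x := jrev (u (- x)).
have dus x : domL beta (us x) by exact: domL_jrev.
have [as_ bas has_] : exists2 a, bounded_reduced_solution beta kappa phib etab mu sigma b P w
    (- conjc d) e a & forall x, let v := comb (a x) in
      Yeq (toY (us x)) (toY (v + w (- conjc d) e x v)).
  apply/(red_equiv rm' dus).
  by apply: bounded_solution_rev bu => x J _; exact: spectral_rhs_rev.
have Pus x : Yeq (P (toY (us x))) (toY (comb (as_ x))).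
  exact: (reduced_solution_proj rm' (has_ x)).
(* At - x - T the Floquet relation reads u (- x) = rho u (- x - T). Reversal conjugates the factor,
   and multiplying by rho moves it to the other side because rho times its conjugate is 1. *)
have qus x : Yeq (toY (us (x + T))) (rho *: toY (us x)).
  have := reduced_solution_shift (- x - T) rm qa; rewrite subrK => /Yeq_srev.
  move=> h; have := Yeq_trans h (eq_Yeq (srevZ rho (toY (u (- x - T))))).
  move=> /Yeq_sym/(YeqZ rho); rewrite scalerA conj_cis scale1r.
  by rewrite /us opprD.
have qas x : as_ (x + T) = rho *: as_ x.
  apply: (combination_inj basis_b).
  apply: (Yeq_trans (Yeq_sym (Pus (x + T)))).
  have iu := domL_inY (dus (x + T)).
  apply: (Yeq_trans (proj_eq proj_P iu (qus x))).
  apply: (Yeq_trans (projZ rho (domL_inY (dus x)))).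
  rewrite -[rho *: as_ x]addr0 combination_lin combination0 addr0 toYZ.
  exact: YeqZ.
have [[as' has'] _] := bas.
have sas : linear_ode (A (- conjc d) e) as_.
  (* The derivative of the coordinates and A times the coordinates give the same combination, so
     independence of the basis identifies them. *)
  move=> x i; have [h1 h2] := has' x.
  rewrite (_ : _ *m _ = as' x); first exact: h1.
  apply: (combination_inj basis_b).
  exact: (Yeq_trans (ceq' x (as_ x)) (Yeq_sym h2)).
exists (as_ 0).
  (* The reflection fixes x = 0, so a zero of [as_] there makes u vanish at 0, hence also its
     projection, whose coordinate vector is v. *)
  apply: contra_neq v0 => as0.
  have us0 : Yeq (toY (us 0)) 0.
    apply: (Yeq_trans (has_ 0)); rewrite as0.
    apply: (Yeq_trans (eq_Yeq (toYD _ _))).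
    rewrite -[X in Yeq _ X]addr0; apply: YeqD; last exact: reduction_map0.
    by rewrite combination0; exact: Yeq_refl.
  have u0 : Yeq (toY (u 0)) 0.
    have := Yeq_srev us0; rewrite -toY_jrev /us jrevK oppr0.
    by have := srevZ 0 (0 : state R); rewrite !scale0r => ->; rewrite conjc0 scale0r.
  have -> : v = a 0 by rewrite /a fX.1 mul1mx.
  apply: (combination_inj basis_b).
  apply: (Yeq_trans (Yeq_sym (reduced_solution_proj rm (Yeq_refl (toY (u 0)))))).
  rewrite combination0.
  have h := Yeq_trans (proj_eq proj_P (domL_inY (du 0)) u0) proj0; exact: h.
have -> : X (- conjc d) e T *m as_ 0 = as_ T.
  have := linear_ode_unique cA' (linear_ode_fundamental (as_ 0) fX') sas.
  by apply; rewrite fX'.1 mul1mx.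
by rewrite -qas add0r.
Qed.

End EvansSymmetry.

Theorem corollary5p2 (R : realType) (beta kappa : R) (e0 : R)
  (phib : R -> R -> R -> R) (etab : R -> R -> R) (mu q : R -> R)
  (sigma kj kj' kr ks : R) (p : int)
  (b : 'I_4 -> jet R) (P : state R -> state R)
  (r0 : R) (w : R[i] -> R -> R -> jet R -> jet R)
  (A X : R[i] -> R -> R -> 'M[R[i]]_4)
  (a1 a0 : R -> R -> R[i]) :
  0 < beta -> 0 < kappa ->
  wave_family beta kappa e0 phib etab mu q ->
  nonresonant beta kappa ->
  1 < mu0 kappa beta ->
  0 < sigma -> ~ critical beta kappa sigma ->
  resonances beta kappa sigma (kj, kj', 1%N) ->
  Ysigma_basis beta kappa sigma b ->
  kr != ks ->
  (forall k : R, Leigenvalue beta kappa sigma (k *i) <->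
     k \in [:: kj; kj'; kr; ks]) ->
  (forall n : int, [/\ kr - kj != n%:~R * kappa, kr - kj' != n%:~R * kappa,
                       ks - kj != n%:~R * kappa & ks - kj' != n%:~R * kappa]) ->
  spectral_projection beta kappa sigma P ->
  0 < r0 ->
  (forall (d : R[i]) (e : R), cabs d < r0 -> `|e| < r0 ->
     [/\ reduction_map beta kappa phib etab mu sigma b P w d e,
         coordinate_system beta kappa phib etab mu sigma b P w d e (A d e)
       & fundamental_matrix (A d e) (X d e)]) ->
  is_weierstrass2 (periodic_evans kappa X) (kj + p%:~R * kappa) a1 a0 ->
  exists2 r : R, 0 < r & forall g e : R, `|g| < r -> `|e| < r ->
    [/\ complex.Re (a1 g e) = 0 /\ complex.Im (a0 g e) = 0,
        complex.Re (- a1 g e / 2) = 0,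
        complex.Im (disc a1 a0 g e) = 0,
        forall d : R[i], weierstrass2 a1 a0 d g e = 0 <->
          d = wroot false a1 a0 g e \/ d = wroot true a1 a0 g e
      & (complex.Re (disc a1 a0 g e) <= 0 ->
           forall s : bool, complex.Re (wroot s a1 a0 g e) = 0) /\
        (0 < complex.Re (disc a1 a0 g e) ->
           forall s : bool, complex.Re (wroot s a1 a0 g e) != 0)].
Proof.
move=> _ kappa_gt0 wave _ _ _ _ _ basis_b _ _ _ proj_P r0_gt0 red weier.
have rm_gt0 : 0 < Num.min r0 e0 by rewrite lt_min r0_gt0 (wave_pos wave).
have sym d k e : cabs d < Num.min r0 e0 -> `|e| < Num.min r0 e0 ->
    periodic_evans kappa X d k e = 0 -> periodic_evans kappa X (- conjc d) k e = 0.
  rewrite !lt_min => /andP[dr _] /andP[er ee].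
  have dr' : cabs (- conjc d) < r0 by rewrite cabsN cabsJ.
  have [rm cs fX] := red d e dr er; have [rm' cs' fX'] := red _ e dr' er.
  apply: evans_symmetric rm rm' cs cs' fX fX' => //.
  - by have [] := wave_C2 wave ee.
  - by move=> x y y01; have [] := wave_phib_sym wave x ee y01.
  - by move=> x; have [] := wave_etab_sym wave x ee.
have [r r_gt0 hr] := weierstrass_symmetric rm_gt0 sym weier.
exists r => // g e hg he; have [a1E a0E] := hr g e hg he.
have discE := disc_real a1E a0E.
have [hle hgt] := Re_sqrtc_real discE.
split => //.
- by rewrite Re_half cReN a1E oppr0 mul0r.
- by move=> d; exact: wrootP.
- split=> hd s; rewrite Re_wroot//.
    by rewrite hle// mulr0 mul0r.
  by rewrite !mulf_neq0 ?signr_eq0 ?invr_eq0 ?pnatr_eq0// hgt.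
Qed.
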